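(* Let $\mathbf n=(n_1,\ldots,n_k)\in\mathbb N^k$, and let $\mathcal M$ be a closed subspace of the Drury-Arveson $\mathbf n$-module $H^2_{\mathbf n}=H^2_{n_1}\otimes H^2_{n_2}\otimes\cdots\otimes H^2_{n_k}$. Let $\mathcal E_{\mathbf n}=H^2_{n_2}\otimes\cdots\otimes H^2_{n_k}$. Then $\mathcal M$ is a submodule of $H^2_{\mathbf n}$ if and only if there exist a Hilbert space $\mathcal E$, a partial isometry $\Theta\in\mathscr M(H^2_{n_1})\overline\otimes\mathcal B(\mathcal E,\mathcal E_{\mathbf n})$, and $\Phi_{ij}\in\mathscr M(H^2_{n_1})\overline\otimes\mathcal B(\mathcal E)$ such that $$\mathcal M=\Theta(H^2_{n_1}\otimes\mathcal E)$$ and $$\mathbf M_{z_{ij}}\Theta=\Theta\Phi_{ij}$$ for all $i=2,\ldots,k$ and $j=1,\ldots,n_i$.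
   Context: For a natural number $n$, the Drury-Arveson space $H^2_n$ is the reproducing kernel Hilbert space on the open unit ball $\mathbb B^n\subset\mathbb C^n$ with kernel $K(\boldsymbol z,\boldsymbol w)=(1-\sum_{i=1}^nz_i\bar w_i)^{-1}$, with multiplication operators $M_{z_1},\dots,M_{z_n}$ by the coordinate functions. $\mathscr M(H^2_n)=\{\varphi\in\mathrm{Hol}(\mathbb B^n):\varphi H^2_n\subseteq H^2_n\}$ is its multiplier algebra, viewed as an algebra of multiplication operators. For Hilbert spaces $\mathcal E,\mathcal E_*$, $\mathscr M(H^2_n)\overline\otimes\mathcal B(\mathcal E,\mathcal E_* )$ is the weakly closed subspace of $\mathcal B(H^2_n\otimes\mathcal E,H^2_n\otimes\mathcal E_* )$ generated by the spatial tensor product of $\mathscr M(H^2_n)$ and $\mathcal B(\mathcal E,\mathcal E_* )$ (i.e. the operator-valued multipliers); $\mathcal B(\mathcal E)=\mathcal B(\mathcal E,\mathcal E)$. On $H^2_{\mathbf n}$, $\mathbf M_{z_{ij}}=I_{H^2_{n_1}}\otimes\cdots\otimes M_{z_{ij}}\otimes\cdots\otimes I_{H^2_{n_k}}$, where $M_{z_{ij}}$ is multiplication by the $j$-th coordinate function on the $i$-th factor $H^2_{n_i}$, $i=1,\dots,k$, $j=1,\dots,n_i$. A closed subspace $\mathcal M\subseteq H^2_{\mathbf n}$ is a submodule if $\mathbf M_{z_{ij}}\mathcal M\subseteq\mathcal M$ for all $i=1,\dots,k$ and $j=1,\dots,n_i$. $H^2_{\mathbf n}$ is identified with $H^2_{n_1}\otimes\mathcal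 E_{\mathbf n}$. *)

(* Defs.v *)
From HB Require Import structures.
From mathcomp Require Import all_boot all_order all_algebra.
From mathcomp Require Import complex.
From mathcomp Require Import all_classical reals topology normedtype derive.
From mathcomp Require Import ring.

Set Implicit Arguments.
Unset Strict Implicit.
Unset Printing Implicit Defensive.

Import Order.TTheory GRing.Theory Num.Theory.
Import numFieldNormedType.Exports.

Local Open Scope classical_set_scope.
Local Open Scope ring_scope.
Local Open Scope complex_scope.

(* The topology and the norm of [R[i]] are those of [R[i]^o]. *)
HB.instance Definition _ (R : realType) := PseudoPointedMetric.copy R[i] R[i]^o.
HB.instance Definition _ (R : realType) := NormedModule.copy R[i] R[i]^o.

(* The norm of a [normedModType R[i]] takes its values in [R[i]]. *)
HB.mixin Record isHilbert (R : realType) V of CompleteNormedModule R[i] V := {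
  inner : V -> V -> R[i];
  innerDl : forall x y z, inner (x + y) z = inner x z + inner y z;
  innerZl : forall (a : R[i]) x y, inner (a *: x) y = a * inner x y;
  inner_conj : forall x y, inner y x = (inner x y)^*;
  inner_norm : forall x, inner x x = `|x| ^+ 2
}.

#[short(type="hilbertType")]
HB.structure Definition Hilbert (R : realType) :=
  {V of isHilbert R V & CompleteNormedModule R[i] V}.

Section HilbertTheory.
Variables (R : realType) (V : hilbertType R).
Implicit Types x y z : V.

Lemma innerNl x y : inner (- x) y = - inner x y.
Proof. by rewrite -scaleN1r innerZl mulN1r. Qed.

Lemma innerBl x y z : inner (x - y) z = inner x z - inner y z.
Proof. by rewrite innerDl innerNl. Qed.

Lemma innerDr x y z : inner x (y + z) = inner x y + inner x z.
Proof. by rewrite inner_conj innerDl rmorphD /= -!inner_conj. Qed.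

Lemma innerBr x y z : inner x (y - z) = inner x y - inner x z.
Proof. by rewrite inner_conj innerBl rmorphB /= -!inner_conj. Qed.

Lemma innerZr (a : R[i]) x y : inner x (a *: y) = a^* * inner x y.
Proof. by rewrite inner_conj innerZl rmorphM /= -inner_conj. Qed.

Lemma inner_eq0 x : inner x x = 0 -> x = 0.
Proof.
by rewrite inner_norm => /eqP; rewrite sqrf_eq0 normr_eq0 => /eqP.
Qed.

End HilbertTheory.

Section Operators.
Variable R : realType.

Definition lin_span (V : lmodType R[i]) (S : set V) : set V :=
  [set v | exists (N : nat) (a : 'I_N -> R[i]) (s : 'I_N -> V),
     (forall l, S (s l)) /\ v = \sum_(l < N) a l *: s l].

Definition is_closed_subspace (V : hilbertType R) (M : set V) : Prop :=
  [/\ closed M, M 0, forall x y, M x -> M y -> M (x + y)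
    & forall (a : R[i]) x, M x -> M (a *: x)].

Record bop (H K : hilbertType R) := Bop {
  bop_fun :> {linear H -> K};
  bop_cont : continuous bop_fun }.

HB.instance Definition _ (H K : hilbertType R) := gen_eqMixin (bop H K).
HB.instance Definition _ (H K : hilbertType R) := gen_choiceMixin (bop H K).

Lemma bop0_cont (H K : hilbertType R) :
  continuous ((\0 : {linear H -> K}) : H -> K).
Proof. by move=> x; apply: cvg_cst. Qed.

Definition bop0 (H K : hilbertType R) : bop H K := Bop (@bop0_cont H K).

Lemma bop1_cont (H : hilbertType R) :
  continuous ((idfun : {linear H -> H}) : H -> H).
Proof. by move=> x; apply: cvg_id. Qed.

Definition bop1 (H : hilbertType R) : bop H H := Bop (@bop1_cont H).

Definition is_partial_isometry (H K : hilbertType R) (A : bop H K) : Prop :=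
  forall x, (forall y, A y = 0 -> inner x y = 0) -> `|A x| = `|x|.

Definition op_span (H K : hilbertType R) (S : set (bop H K)) : set (bop H K) :=
  [set A | exists (N : nat) (a : 'I_N -> R[i]) (B : 'I_N -> bop H K),
     (forall l, S (B l)) /\ forall x, A x = \sum_(l < N) a l *: B l x].

Definition op_norm_closure (H K : hilbertType R) (S : set (bop H K)) :
    set (bop H K) :=
  [set A | forall e : R[i], 0 < e ->
     exists2 B, S B & forall x, `|A x - B x| <= e * `|x| ].

Definition op_weak_closure (H K : hilbertType R) (S : set (bop H K)) :
    set (bop H K) :=
  [set A | forall (e : R[i]) (N : nat) (x : 'I_N -> H) (y : 'I_N -> K), 0 < e ->
     exists2 B, S B & forall l, `|inner (A (x l) - B (x l)) (y l)| < e].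

End Operators.

(* A Hilbert space tensor product is determined, up to a unique unitary
   compatible with the elementary tensors, by the inner products of elementary
   tensors and the density of their span; multilinearity of the elementary
   tensors is a consequence (see [tens2Dl] below). *)

Section Tensor.
Variable R : realType.

Record tensor2 (H K : hilbertType R) := Tensor2 {
  t2_space :> hilbertType R;
  tens2 : H -> K -> t2_space;
  tens2_inner : forall x x' y y',
    inner (tens2 x y) (tens2 x' y') = inner x x' * inner y y';
  tens2_dense :
    dense (lin_span [set v | exists x y, v = tens2 x y]) }.

Record tensorn (I : finType) (H : I -> hilbertType R) := Tensorn {
  tn_space :> hilbertType R;
  tens : (forall i, H i) -> tn_space;
  tens_inner : forall f g,
    inner (tens f) (tens g) = \prod_(i : I) inner (f i) (g i);
  tens_dense : dense (lin_span [set v | exists f, v = tens f]) }.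

Section Tensor2Linear.
Variables (H K : hilbertType R) (T : tensor2 H K).

Lemma tens2Dl x x' y :
  tens2 T (x + x') y = tens2 T x y + tens2 T x' y.
Proof.
apply/eqP; rewrite -subr_eq0; apply/eqP/inner_eq0.
rewrite !(innerBl, innerBr, innerDl, innerDr, tens2_inner).
by rewrite !mulrDl; ring.
Qed.

Lemma tens2Dr x y y' :
  tens2 T x (y + y') = tens2 T x y + tens2 T x y'.
Proof.
apply/eqP; rewrite -subr_eq0; apply/eqP/inner_eq0.
rewrite !(innerBl, innerBr, innerDl, innerDr, tens2_inner).
by ring.
Qed.

Lemma tens2Zl (a : R[i]) x y : tens2 T (a *: x) y = a *: tens2 T x y.
Proof.
apply/eqP; rewrite -subr_eq0; apply/eqP/inner_eq0.
rewrite !(innerBl, innerBr, innerZl, innerZr, tens2_inner).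
by ring.
Qed.

Lemma tens2Zr (a : R[i]) x y : tens2 T x (a *: y) = a *: tens2 T x y.
Proof.
apply/eqP; rewrite -subr_eq0; apply/eqP/inner_eq0.
rewrite !(innerBl, innerBr, innerZl, innerZr, tens2_inner).
by ring.
Qed.

Lemma tens2_norm x y : `|tens2 T x y| = `|x| * `|y|.
Proof.
apply/eqP; rewrite -(eqrXn2 (n := 2)) ?mulr_ge0 //.
by rewrite exprMn -!inner_norm tens2_inner.
Qed.

End Tensor2Linear.
End Tensor.


Section LinSpan.
Variables (R : realType) (V : hilbertType R) (S : set V).

Lemma lin_span0 : lin_span S 0.
Proof.
exists 0%N, (fun=> 0), (fun=> 0); split; first by case.
by rewrite big_ord0.
Qed.

Lemma lin_spanD x y : lin_span S x -> lin_span S y -> lin_span S (x + y).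
Proof.
move=> [N [a [s [sS ->]]]] [P [b [t [tS ->]]]].
exists (N + P)%N.
exists (fun l => match fintype.split l with inl i => a i | inr i => b i end).
exists (fun l => match fintype.split l with inl i => s i | inr i => t i end).
split; first by move=> l; case: (fintype.split l).
rewrite big_split_ord /=; congr (_ + _); apply: eq_bigr => l _.
  by rewrite -[lshift P l]/(unsplit (inl l)) unsplitK.
by rewrite -[rshift N l]/(unsplit (inr l)) unsplitK.
Qed.

Lemma lin_spanZ (c : R[i]) x : lin_span S x -> lin_span S (c *: x).
Proof.
move=> [N [a [s [sS ->]]]]; exists N, (fun l => c * a l), s; split=> //.
by rewrite scaler_sumr; apply: eq_bigr => l _; rewrite scalerA.
Qed.

Lemma lin_span_sub x : S x -> lin_span S x.
Proof.
move=> Sx; exists 1%N, (fun=> 1), (fun=> x); split=> //.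
by rewrite big_ord1 scale1r.
Qed.

End LinSpan.

Lemma hilbert_denseP (R : realType) (V : hilbertType R) (S : set V) :
  dense S <-> forall x (e : R[i]), 0 < e -> exists2 s, S s & `|x - s| < e.
Proof.
split=> [dS x e e0|dS O [x Ox] oO].
  have [|s [xs Ss]] := dS _ _ (@ball_open _ V x e).
    by exists x; exact: ballxx.
  by exists s => //; move: xs; rewrite -ball_normE.
have /nbhs_ballP[e /= e0 xeO] : nbhs x O by exact: open_nbhs_nbhs.
have [s Ss xs] := dS x e e0.
by exists s; split=> //; apply: xeO; rewrite -ball_normE.
Qed.

Section TensorCons.
Variables (R : realType) (k : nat) (H : 'I_k.+1 -> hilbertType R).
Variables (E : tensorn (fun i : 'I_k => H (lift ord0 i))).
Variable (T : tensor2 (H ord0) E).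

Definition tail_fam (f : forall i, H i) : forall i : 'I_k, H (lift ord0 i) :=
  fun i => f (lift ord0 i).

Definition tens_cons (f : forall i, H i) : T :=
  tens2 T (f ord0) (tens E (tail_fam f)).

Lemma tens_cons_inner f g :
  inner (tens_cons f) (tens_cons g) = \prod_(i < k.+1) inner (f i) (g i).
Proof. by rewrite tens2_inner tens_inner big_ord_recl. Qed.

Lemma fam_consP (x : H ord0) (g : forall i : 'I_k, H (lift ord0 i)) :
  exists2 f : forall i, H i, f ord0 = x & tail_fam f = g.
Proof.
pose P (i : 'I_k.+1) (y : H i) :=
  (forall e : ord0 = i, y = eq_rect ord0 H x i e) /\
  (forall j (e : lift ord0 j = i), y = eq_rect _ H (g j) i e).
have Pex : forall i, exists y, P i y.
  move=> i; case: (unliftP ord0 i) => [j ->|->].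
    exists (g j); split=> [e|j' e].
      by exfalso; have := neq_lift ord0 j; rewrite -e eqxx.
    have jj' := lift_inj e; case: _ / jj' e => e.
    by rewrite [e]eq_axiomK.
  exists x; split=> [e|j e]; first by rewrite [e]eq_axiomK.
  by exfalso; have := neq_lift ord0 j; rewrite e eqxx.
pose f i := sval (cid (Pex i)); have fP i : P i (f i) := svalP (cid (Pex i)).
exists f; first by have [/(_ erefl)] := fP ord0.
apply: functional_extensionality_dep => j.
by have [_ /(_ j erefl)] := fP (lift ord0 j).
Qed.

Lemma tens_cons_dense : dense (lin_span [set v | exists f, v = tens_cons f]).
Proof.
set D := lin_span _.
pose P v := forall e : R[i], 0 < e -> exists2 s, D s & `|v - s| < e.
have P0 : P 0.
  by move=> e e0; exists 0; [exact: lin_span0|rewrite subrr normr0].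
have PD v w : P v -> P w -> P (v + w).
  move=> Pv Pw e e0; have e20 : 0 < e / 2 by rewrite divr_gt0.
  have [s Ds vs] := Pv _ e20; have [t Dt wt] := Pw _ e20.
  exists (s + t); first exact: lin_spanD.
  rewrite opprD addrACA (splitr e).
  exact: le_lt_trans (ler_normD _ _) (ltrD vs wt).
have PZ (c : R[i]) v : P v -> P (c *: v).
  move=> Pv e e0; have c0 : 0 < `|c| + 1 by rewrite ltr_wpDl.
  have [s Ds vs] := Pv _ (divr_gt0 e0 c0).
  exists (c *: s); first exact: lin_spanZ.
  rewrite -scalerBr normrZ; move: vs; rewrite ltr_pdivlMr // => vs.
  by apply: le_lt_trans vs; rewrite mulrC ler_wpM2l // lerDl.
have Ptens x y : P (tens2 T x y).
  move=> e e0; have x0 : 0 < `|x| + 1 by rewrite ltr_wpDl.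
  have [s [N [a [t [tE ->]]]] ys] :=
    (hilbert_denseP _).1 (@tens_dense _ _ _ E) y _ (divr_gt0 e0 x0).
  exists (tens2 T x (\sum_(l < N) a l *: t l)).
    have -> : tens2 T x (\sum_(l < N) a l *: t l) =
              \sum_(l < N) a l *: tens2 T x (t l).
      have tx0 : tens2 T x 0 = 0.
        by rewrite -[0 in LHS](scale0r 0) tens2Zr scale0r.
      rewrite (big_morph (tens2 T x) (tens2Dr T x) tx0).
      by apply: eq_bigr => l _; rewrite tens2Zr.
    apply: (big_ind D) => [|u v|l _]; [exact: lin_span0|exact: lin_spanD|].
    apply/lin_spanZ/lin_span_sub; have [g ->] := tE l.
    by have [f fx fg] := fam_consP x g; exists f; rewrite /tens_cons fx fg.
  have -> : tens2 T x y - tens2 T x (\sum_(l < N) a l *: t l) =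
            tens2 T x (y - \sum_(l < N) a l *: t l).
    by rewrite tens2Dr -[in RHS]scaleN1r tens2Zr scaleN1r.
  rewrite tens2_norm; move: ys; rewrite ltr_pdivlMr // => ys.
  by apply: le_lt_trans ys; rewrite mulrC ler_wpM2l // lerDl.
apply/hilbert_denseP => v e e0; have e20 : 0 < e / 2 by rewrite divr_gt0.
have [u [N [a [t [tT ->]]]] vu] :=
  (hilbert_denseP _).1 (@tens2_dense _ _ _ T) v _ e20.
have Pu : P (\sum_(l < N) a l *: t l).
  apply: (big_ind P) => // l _; apply: PZ.
  by have [x [y ->]] := tT l.
have [s Ds us] := Pu _ e20; exists s => //.
rewrite -(subrKA (\sum_(l < N) a l *: t l)) (splitr e).
exact: le_lt_trans (ler_normD _ _) (ltrD vu us).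
Qed.

(* The identification of H_0 (x) (H_1 (x) ... (x) H_k) with the tensor product
   of all the H_i. *)
Definition tensor_cons : tensorn H :=
  @Tensorn R 'I_k.+1 H T tens_cons tens_cons_inner tens_cons_dense.

End TensorCons.

Section RKHS.
Variables (R : realType) (X : Type) (K : X -> X -> R[i]).

(* A Hilbert space of functions on [X]: the vector [f] stands for the function
   [rk_eval f]; linearity of [rk_eval] follows from [rk_reproducing]. *)
Record rkhs := Rkhs {
  rk_space :> hilbertType R;
  rk_eval : rk_space -> X -> R[i];
  rk_eval_inj : injective rk_eval;
  rk_kernel : X -> rk_space;
  rk_reproducing : forall f w, rk_eval f w = inner f (rk_kernel w);
  rk_kernelE : forall w z, rk_eval (rk_kernel w) z = K z w }.

End RKHS.

Section DruryArveson.
Variables (R : realType) (n : nat).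

Definition unit_ball : set 'rV[R[i]]_n :=
  [set z | \sum_(i < n) `|z ord0 i| ^+ 2 < 1].

Definition da_kernel (z w : unit_ball) : R[i] :=
  (1 - \sum_(i < n) val z ord0 i * (val w ord0 i)^*)^-1.

Definition drury_arveson := rkhs da_kernel.

Definition holomorphic_on_ball (phi : 'rV[R[i]]_n -> R[i]) : Prop :=
  forall z, unit_ball z -> differentiable phi z.

Variable H : drury_arveson.

(* Only the values of [phi] on the ball matter. *)
Definition is_multiplier (phi : 'rV[R[i]]_n -> R[i]) : Prop :=
  holomorphic_on_ball phi /\
  forall f : H, exists g : H, forall z : unit_ball,
    rk_eval g z = phi (val z) * rk_eval f z.

Definition is_mulop (phi : 'rV[R[i]]_n -> R[i]) (A : bop H H) : Prop :=
  forall f (z : unit_ball), rk_eval (A f) z = phi (val z) * rk_eval f z.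

Definition multiplier_algebra : set (bop H H) :=
  [set A | exists2 phi, is_multiplier phi & is_mulop phi A].

(* The operator [M_phi]: it is unique, and by the closed graph theorem the
   default [0] is only reached when [phi] is not a multiplier. *)
Definition mulop (phi : 'rV[R[i]]_n -> R[i]) : bop H H :=
  xget (bop0 H H) [set A | is_mulop phi A].

Definition coord_mulop (j : 'I_n) : bop H H := mulop (fun z => z ord0 j).

End DruryArveson.

Arguments multiplier_algebra {R n} H.

Definition elementary_ops (R : realType) (H E F : hilbertType R)
    (TE : tensor2 H E) (TF : tensor2 H F) (S : set (bop H H)) :
    set (bop TE TF) :=
  [set C | exists A (B : bop E F), S A /\
     forall x y, C (tens2 TE x y) = tens2 TF (A x) (B y)].
Arguments elementary_ops {R H E F} TE TF S.

Definition spatial_tensor (R : realType) (H E F : hilbertType R)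
    (TE : tensor2 H E) (TF : tensor2 H F) (S : set (bop H H)) :
    set (bop TE TF) :=
  op_norm_closure (op_span (elementary_ops TE TF S)).
Arguments spatial_tensor {R H E F} TE TF S.

(* The weak closure of a linear subspace is the weakly closed subspace that it
   generates. *)
Definition weak_tensor (R : realType) (H E F : hilbertType R)
    (TE : tensor2 H E) (TF : tensor2 H F) (S : set (bop H H)) :
    set (bop TE TF) :=
  op_weak_closure (spatial_tensor TE TF S).
Arguments weak_tensor {R H E F} TE TF S.

(* The bounded operator acting as [A i] on every factor; it always exists and is
   unique, so that the default [0] is never reached. *)
Definition tens_op (R : realType) (I : finType) (H : I -> hilbertType R)
    (T : tensorn H)
    (A : forall i, bop (H i) (H i)) : bop T T :=
  xget (bop0 T T)
    [set B | forall f, B (tens T f) = tens T (fun i => A i (f i))].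

Definition ampliation (R : realType) (I : finType) (H : I -> hilbertType R)
    (T : tensorn H)
    (i : I) (A : bop (H i) (H i)) : bop T T :=
  tens_op T (dfwith (fun l => bop1 (H l)) i A).

Section Modules.
Variables (R : realType) (k : nat) (n : 'I_k -> nat).
Variables (H : forall i, drury_arveson R (n i)) (T : tensorn H).

Definition coord_op (i : 'I_k) (j : 'I_(n i)) : bop T T :=
  ampliation T (coord_mulop (H i) j).

Definition is_submodule (M : set T) : Prop :=
  forall (i : 'I_k) (j : 'I_(n i)) x, M x -> M (coord_op j x).

End Modules.

Arguments coord_op {R k n H} T {i} j.

(* Main.v *)
Require Import Defs.
From HB Require Import structures.
From mathcomp Require Import all_boot all_order all_algebra.
From mathcomp Require Import complex.
From mathcomp Require Import all_classical reals topology normedtype derive sequences.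
From mathcomp Require Import ring lra.

Set Implicit Arguments.
Unset Strict Implicit.
Unset Printing Implicit Defensive.

Import Order.TTheory GRing.Theory Num.Theory.
Import numFieldNormedType.Exports.

Local Open Scope classical_set_scope.
Local Open Scope ring_scope.
Local Open Scope complex_scope.

(* Write [S_j] for the shifts of [H = H^2_{n_1}], [T = H (x) F], [A'] for the
   adjoint of [A], [P] for the projection on [M] and [k_w] for the kernel
   functions. Every contraction [C : E (+) G^n -> E2 (+) G] defines a multiplier
   whose adjoint maps [k_w (x) u] to [k_w (x) e], where [e] and a state [h] solve
   [(e, h) = C (u, conj w_1 h, ..., conj w_n h)]; with [r w], [r < 1], instead of
   [w] it is a norm limit of polynomials in the shifts, and [r -> 1] gives a weak
   limit.
   If [M] is invariant under the [S_j], then [P - sum_j S_j P S_j'] is positive;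
   writing it as [L' L], the operator [Theta] with
   [Theta' (k_w (x) y) = k_w (x) L (k_w (x) y)] satisfies [Theta Theta' = P]. It
   is realized by the contraction [C] provided by the identity
   [|L x|^2 + |(1 - P) x|^2 = |k_0' x|^2 + sum_j |(1 - P) S_j' x|^2].
   If [M] is also invariant under [X = I (x) B], take [Y = X' / c] with [c]
   larger than the norm of [X] and [G' G = P - Y' P Y]. The identity
   [|L Y x|^2 + |G x|^2 = |L x|^2 + sum_j |G S_j' x|^2] then realizes the
   multiplier [Phi] with [X Theta = c Theta Phi]. *)

(** Two facts about the shifts carry the proof. The vectors [k_w (x) y] are joint eigenvectors of
    the [S_j'] with eigenvalues [conj w_j], so multiplying the kernel of an operator [A] by
    [1 - <z, w>] amounts to replacing [A] by [A - sum_j S_j A S_j']. And [1 - sum_j S_j S_j'] is the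
    projection on [1 (x) F], which is where the term [|k_0' x|^2] comes from. The argument calls for
    direct sums, square roots and an auxiliary space [E]; all are found inside [T]. Since [H] is
    separable and, as [n_1 > 0], infinite dimensional, [H (x) T] can be carried by [T], and [E] can
    be [T] itself. For an orthonormal basis [e_i] of [H], the maps [V_i = e_i (x) .] are then
    isometries of [T] with orthogonal ranges. Sums of their values replace direct sums, and they
    also assemble [L] and [G], for which any factorization [A = L' L] will do in place of a positive
    square root. The converse uses no realization: operators in the weak closure intertwine the
    shifts of the first factor, and the [Phi_ij] take care of the other factors. *)

Section Norm.
Variables (R : realType).

(* The norm of a normed module over [R[i]] lives in [R[i]]; [nr] is its real value. *)
Definition nr (V : normedZmodType R[i]) (x : V) : R := complex.Re `|x|.

Lemma nrE (V : normedZmodType R[i]) (x : V) : `|x| = (nr x)%:C.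
Proof. by rewrite /nr RRe_real // ger0_real. Qed.

Lemma gt0_complex (e : R[i]) : 0 < e -> exists2 r : R, 0 < r & e = r%:C.
Proof.
rewrite ltcE /= => /andP[/eqP i0 r0]; exists (complex.Re e) => //.
by case: e i0 {r0} => a b /= ->.
Qed.

Lemma nr_ge0 (V : normedZmodType R[i]) (x : V) : 0 <= nr x.
Proof. by rewrite -ler0c -nrE. Qed.

Lemma nrD (V : normedZmodType R[i]) (x y : V) : nr (x + y) <= nr x + nr y.
Proof. by rewrite -lecR rmorphD /= -!nrE ler_normD. Qed.

Lemma nrN (V : normedZmodType R[i]) (x : V) : nr (- x) = nr x.
Proof. by rewrite /nr normrN. Qed.

Lemma nrB (V : normedZmodType R[i]) (x y : V) : nr (x - y) = nr (y - x).
Proof. by rewrite -nrN opprB. Qed.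

Lemma nr0 (V : normedZmodType R[i]) : nr (0 : V) = 0.
Proof. by rewrite /nr normr0. Qed.

Lemma nr_eq0 (V : normedZmodType R[i]) (x : V) : (nr x == 0) = (x == 0).
Proof. by rewrite -(inj_eq (@complexI R)) -nrE normr_eq0. Qed.

Lemma nrZ (V : normedModType R[i]) (a : R[i]) (x : V) : nr (a *: x) = nr a * nr x.
Proof. by apply: (@complexI R); rewrite rmorphM /= -!nrE normrZ. Qed.

Lemma nrM (a b : R[i]) : nr (a * b) = nr a * nr b.
Proof. by apply: (@complexI R); rewrite rmorphM /= -!nrE normrM. Qed.

Lemma nrR (a : R) : nr (a%:C : R[i]) = `|a|.
Proof. by rewrite /nr normc_def /= expr0n /= addr0 sqrtr_sqr. Qed.

Lemma nr_Re (a : R[i]) : complex.Re a <= nr a.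
Proof. by apply: le_trans (ler_norm _) _; rewrite -lecR -nrE normc_ge_Re. Qed.

(* [^*] is parsed as [conjc] or [Num.conj] depending on the context. *)
Definition cj (a : R[i]) : R[i] := conjc a.

Lemma cjD a b : cj (a + b) = cj a + cj b.
Proof. exact: (rmorphD (@conjc R)). Qed.

Lemma cjM a b : cj (a * b) = cj a * cj b.
Proof. exact: (rmorphM (@conjc R)). Qed.

Lemma cjN a : cj (- a) = - cj a.
Proof. exact: (rmorphN (@conjc R)). Qed.

Lemma cj_sum (I : Type) (r : seq I) (P : pred I) (F : I -> R[i]) :
  cj (\sum_(i <- r | P i) F i) = \sum_(i <- r | P i) cj (F i).
Proof. exact: (rmorph_sum (@conjc R)). Qed.

Lemma cj_real (a : R) : cj a%:C = a%:C.
Proof. exact: conjc_real. Qed.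

Lemma cj0 : cj 0 = 0. Proof. exact: conjc0. Qed.

Lemma cj1 : cj 1 = 1. Proof. exact: conjc1. Qed.

Lemma cjK : involutive cj. Proof. exact: conjcK. Qed.

Lemma nr_cj (a : R[i]) : nr (cj a) = nr a.
Proof. by rewrite /nr /cj normcJ. Qed.

Lemma cjM_nr (a : R[i]) : cj a * a = (nr a ^+ 2)%:C.
Proof. by rewrite mulrC /cj -sqr_normc nrE -rmorphXn. Qed.

Lemma nr_sum (V : normedZmodType R[i]) (I : Type) (r : seq I) (P : pred I) (F : I -> V) :
  nr (\sum_(i <- r | P i) F i) <= \sum_(i <- r | P i) nr (F i).
Proof.
elim/big_ind2: _ => [|a x b y ax byy|//]; first by rewrite nr0.
exact: le_trans (nrD _ _) (lerD ax byy).
Qed.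

Lemma nr_small (V : normedZmodType R[i]) (x : V) :
  (forall e : R, 0 < e -> nr x <= e) -> x = 0.
Proof.
move=> h; apply/eqP; rewrite -nr_eq0; rewrite eq_le nr_ge0 andbT.
by apply/ler_addgt0Pl => e e0; rewrite addr0 h.
Qed.

Lemma inv_small (e : R) : 0 < e ->
  exists N, forall k, (N <= k)%N -> k.+1%:R^-1 <= e.
Proof.
move=> e0; exists (Num.trunc e^-1) => k Nk.
rewrite -[e]invrK lef_pV2 ?posrE ?invr_gt0 ?ltr0n //.
by apply: ltW; apply: lt_le_trans (truncnS_gt _) _; rewrite ler_nat.
Qed.

End Norm.

(** * Inner products, the Cauchy-Schwarz inequality and completeness *)

Section Inner.
Variables (R : realType) (V : hilbertType R).
Implicit Types x y z : V.

Lemma innerxx x : inner x x = (nr x ^+ 2)%:C.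
Proof. by rewrite inner_norm nrE rmorphXn. Qed.

Lemma inner_cj x y : inner y x = cj (inner x y).
Proof. exact: inner_conj. Qed.

Lemma innerZr' (a : R[i]) x y : inner x (a *: y) = cj a * inner x y.
Proof. by rewrite inner_cj innerZl cjM -inner_cj. Qed.

Lemma inner0l y : inner 0 y = 0.
Proof. by rewrite -(scale0r 0) innerZl mul0r. Qed.

Lemma inner0r x : inner x 0 = 0.
Proof. by rewrite -(scale0r 0) innerZr' cj0 mul0r. Qed.

Lemma innerNr x y : inner x (- y) = - inner x y.
Proof. by rewrite -scaleN1r innerZr' cjN cj1 mulN1r. Qed.

Lemma inner_suml (I : Type) (r : seq I) (P : pred I) (F : I -> V) y :
  inner (\sum_(i <- r | P i) F i) y = \sum_(i <- r | P i) inner (F i) y.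
Proof.
by rewrite (big_morph (fun x => inner x y) (fun a b => innerDl a b y) (inner0l y)).
Qed.

Lemma inner_sumr (I : Type) (r : seq I) (P : pred I) (F : I -> V) y :
  inner y (\sum_(i <- r | P i) F i) = \sum_(i <- r | P i) inner y (F i).
Proof.
by rewrite (big_morph (fun x => inner y x) (fun a b => innerDr y a b) (inner0r y)).
Qed.

Lemma nr_sqE x : nr x ^+ 2 = complex.Re (inner x x).
Proof. by rewrite innerxx. Qed.

Lemma nr_sqD x y : nr (x + y) ^+ 2 = nr x ^+ 2 + nr y ^+ 2 + 2 * complex.Re (inner x y).
Proof.
rewrite !nr_sqE !innerDl !innerDr (inner_cj x y).
case: (inner x x) (inner x y) (inner y y) => a b [c d] [e f] /=; ring.
Qed.

Lemma nr_sqB x y : nr (x - y) ^+ 2 = nr x ^+ 2 + nr y ^+ 2 - 2 * complex.Re (inner x y).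
Proof. by rewrite nr_sqD nrN innerNr raddfN /= mulrN. Qed.

Lemma parallelogram x y :
  nr (x - y) ^+ 2 = 2 * nr x ^+ 2 + 2 * nr y ^+ 2 - nr (x + y) ^+ 2.
Proof. by rewrite nr_sqB nr_sqD; ring. Qed.

Lemma pythagoras x y : inner x y = 0 -> nr (x + y) ^+ 2 = nr x ^+ 2 + nr y ^+ 2.
Proof. by move=> h; rewrite nr_sqD h /= mulr0 addr0. Qed.

Lemma cauchy_schwarz x y : nr (inner x y) <= nr x * nr y.
Proof.
have [->|y0] := eqVneq y 0; first by rewrite inner0r !nr0 mulr0.
have ny : 0 < nr y by rewrite lt_neqAle eq_sym nr_eq0 y0 nr_ge0.
(* [t *: y] is the orthogonal projection of [x] on the line spanned by [y]. *)
set c := inner x y; pose t := (nr y ^- 2)%:C * c.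
have : 0 <= nr (x - t *: y) ^+ 2 by rewrite sqr_ge0.
rewrite nr_sqB nrZ innerZr' -/c /t nrM nrR.
have -> : cj ((nr y ^- 2)%:C * c) * c = (nr y ^- 2 * nr c ^+ 2)%:C.
  by rewrite cjM cj_real -mulrA cjM_nr -rmorphM.
rewrite /= ger0_norm ?invr_ge0 ?sqr_ge0 //.
have -> : nr x ^+ 2 + (nr y ^- 2 * nr c * nr y) ^+ 2 - 2 * (nr y ^- 2 * nr c ^+ 2)
  = nr x ^+ 2 - (nr c / nr y) ^+ 2 by field; rewrite gt_eqF.
rewrite subr_ge0 => h; rewrite -ler_pdivrMr //.
by rewrite -(ler_pXn2r (n:=2)) ?nnegrE ?divr_ge0 ?nr_ge0.
Qed.

Lemma inner_ext x y : (forall z, inner x z = inner y z) -> x = y.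
Proof.
move=> h; apply/eqP; rewrite -subr_eq0; apply/eqP/inner_eq0.
by rewrite innerBl h subrr.
Qed.

Lemma hilbert_complete (u : nat -> V) :
  (forall e : R, 0 < e -> exists N, forall m n, (N <= m)%N -> (N <= n)%N -> nr (u m - u n) <= e) ->
  exists l, forall e : R, 0 < e -> exists N, forall n, (N <= n)%N -> nr (l - u n) <= e.
Proof.
move=> uC.
have : cvg (u @ \oo).
  apply: cauchy_cvg; apply: cauchy_exP => e e0.
  have [e' e'0 ->] := gt0_complex e0.
  have [N hN] := uC _ (divr_gt0 e'0 (ltr0n _ 2)).
  exists (u N); exists N => // m /= Nm; rewrite -ball_normE /= nrE ltcR.
  apply: le_lt_trans (hN _ _ _ _) _ => //; lra.
move=> /cvg_ex[l ul]; exists l => e e0.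
have e0' : (0 : R[i]) < e%:C by rewrite ltcR.
have [N _ hN] := ((cvgrPdist_lt (F:=\oo) u l).1 ul) _ e0'.
by exists N => n /hN /=; rewrite nrE ltcR => /ltW.
Qed.

End Inner.

(** Pairing with an arbitrary vector moves an identity between vectors to the field [R[i]], where
    [ring] applies. *)
Ltac vring :=
  apply: inner_ext => ?; rewrite ?(innerBl, innerDl, innerZl, innerNl, inner0l); ring.

(** * Projections and adjoints *)

Section Hilbert.
Variable R : realType.
Implicit Types V W : hilbertType R.

Lemma closed_lim V (M : set V) (p : V) :
  closed M -> (forall e : R, 0 < e -> exists2 m, M m & nr (p - m) <= e) -> M p.
Proof.
move=> cM h; apply: cM => B /nbhs_ballP[e /= e0 eB].
have [e' e'0 ee'] := gt0_complex e0.
have e20 : 0 < e' / 2 by lra.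
have [m Mm pm] := h _ e20; exists m; split=> //; apply: eB.
rewrite -ball_normE /= nrE ee' ltcR; lra.
Qed.

Lemma closedP V (M : set V) :
  (forall p : V, (forall e : R, 0 < e -> exists2 m, M m & nr (p - m) <= e) -> M p) ->
  closed M.
Proof.
move=> h p pM; apply: h => e e0.
have e0' : (0 : R[i]) < e%:C by rewrite ltcR.
have [m [Mm]] := pM _ (nbhsx_ballx p _ e0').
by rewrite -ball_normE /= nrE ltcR => /ltW pm; exists m.
Qed.

Lemma ler_sq (x y : R) : 0 <= y -> x ^+ 2 <= y ^+ 2 -> x <= y.
Proof. by move=> y0 h; rewrite leNgt; apply/negP => yx; nra. Qed.

Lemma minimal_orthogonal V (M : set V) (q : V) :
  (forall (a : R[i]) x, M x -> M (a *: x)) ->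
  (forall m, M m -> nr q ^+ 2 <= nr (q - m) ^+ 2) -> forall m, M m -> inner q m = 0.
Proof.
move=> MZ hq m Mm; set c := inner q m.
(* Subtracting [t c m] from [q] changes the squared norm by [- t |c|^2 (2 - t |m|^2)]. The [+ 1]
   gives [t |m|^2 = 1 - t < 1] and covers [m = 0]. *)
pose t : R := (nr m ^+ 2 + 1)^-1.
have d0 : 0 < nr m ^+ 2 + 1 by rewrite ltr_wpDl ?sqr_ge0.
have := hq _ (MZ (t%:C * c) m Mm).
rewrite nr_sqB nrZ innerZr' -/c nrM nrR.
have -> : cj (t%:C * c) * c = (t * nr c ^+ 2)%:C by rewrite cjM cj_real -mulrA cjM_nr [RHS]rmorphM.
rewrite /= ger0_norm ?invr_ge0 ?(ltW d0) // => h.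
have td : t * nr m ^+ 2 = 1 - t.
  by rewrite /t; field; rewrite gt_eqF.
have t0 : 0 < t by rewrite invr_gt0.
apply/eqP; rewrite -nr_eq0 -sqrf_eq0 eq_le sqr_ge0 andbT.
rewrite -(pmulr_rle0 _ t0).
have : (t * nr c * nr m) ^+ 2 = t * nr c ^+ 2 * (1 - t) by rewrite -td; ring.
have : 0 <= t * nr c ^+ 2 * t by do 2?apply: mulr_ge0; rewrite ?sqr_ge0 ?(ltW t0).
nra.
Qed.

Lemma projection V (M : set V) (x : V) : is_closed_subspace M ->
  exists2 p, M p & forall m, M m -> inner (x - p) m = 0.
Proof.
move=> [cM M0 MD MZ].
pose A : set R := [set nr (x - m) ^+ 2 | m in M].
have Ainf : has_inf A.
  split; first by exists (nr (x - 0) ^+ 2), 0.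
  by exists 0 => _ [m _ <-]; rewrite sqr_ge0.
pose d := inf A.
have dle m : M m -> d <= nr (x - m) ^+ 2.
  by move=> Mm; apply: ge_inf; [exact: Ainf.2|exists m].
have hseq (k : nat) : exists m, M m /\ nr (x - m) ^+ 2 < d + k.+1%:R^-1.
  have [|_ [m Mm <-] hm] := @inf_adherent _ A k.+1%:R^-1 _ Ainf.
    by rewrite invr_gt0 ltr0n.
  by exists m.
have [u hu] := choice hseq.
have uC : forall e : R, 0 < e -> exists N, forall m n, (N <= m)%N -> (N <= n)%N ->
    nr (u m - u n) <= e.
  (* Midpoints stay in [M], so the parallelogram law bounds [|u_i - u_j|^2] by [2 (d + e^2/4) + 2 (d
     + e^2/4) - 4 d = e^2]. *)
  move=> e e0; have [N hN] := inv_small (e := e ^+ 2 / 4) (divr_gt0 (exprn_gt0 2 e0) (ltr0n _ 4)).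
  exists N => i j Ni Nj; apply: ler_sq; first exact: ltW.
  have -> : u i - u j = (x - u j) - (x - u i) by rewrite opprB [RHS]addrC subrKA.
  rewrite parallelogram.
  have hd := dle _ (MZ (2^-1) _ (MD _ _ (hu i).1 (hu j).1)).
  have -> : nr (x - u j + (x - u i)) ^+ 2 = 4 * nr (x - (2^-1 : R[i]) *: (u i + u j)) ^+ 2.
    have -> : x - u j + (x - u i) = (2%:R : R)%:C *: (x - (2^-1 : R[i]) *: (u i + u j)).
      rewrite rmorph_nat scalerBr scalerA divff ?pnatr_eq0 // scale1r scaler_nat mulr2n.
      by rewrite addrACA -opprD (addrC (u j)).
    by rewrite nrZ nrR ger0_norm ?ler0n // exprMn; congr (_ * _); ring.
  have := (hu i).2; have := (hu j).2; have := hN _ Ni; have := hN _ Nj.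
  move: hd; set a := nr (x - _ *: _) ^+ 2; set b := nr (x - u j) ^+ 2; set c := nr (x - u i) ^+ 2.
  move: a b c (i.+1%:R^-1) (j.+1%:R^-1) => a b c a' b'; lra.
have [p pl] := hilbert_complete uC.
have Mp : M p.
  by apply: (closed_lim cM) => e /pl[N hN]; exists (u N); [exact: (hu N).1|exact: hN].
exists p => //; apply: minimal_orthogonal => // m Mm.
rewrite -addrA -opprD; apply: le_trans _ (dle _ (MD _ _ Mp Mm)).
apply/ler_addgt0Pr => e e0.
pose B := 2 * nr (x - p) + 2.
have B0 : 0 < B by rewrite ltr_wpDl ?mulr_ge0 ?nr_ge0.
pose e' := Num.min 1 (e / (2 * B)).
have e'0 : 0 < e' by rewrite lt_min ltr01 divr_gt0 // mulr_gt0.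
have [N1 h1] := pl _ e'0; have [N2 h2] := inv_small (e := e / 2) (divr_gt0 e0 (ltr0n _ 2)).
pose k := maxn N1 N2.
have := (hu k).2; have := h2 k (leq_maxr _ _); have := h1 k (leq_maxl _ _).
have tri : nr (x - p) <= nr (x - u k) + nr (p - u k).
  by rewrite (nrB p) -(subrKA (u k) x); exact: nrD.
move=> a1 a2 a3.
have e'1 : e' <= 1 by rewrite ge_min lexx.
have e'2 : e' * B <= e / 2.
  have : e' <= e / (2 * B) by rewrite ge_min lexx orbT.
  rewrite ler_pdivlMr ?mulr_gt0 // => ?; lra.
rewrite /B in e'2.
have t2 : nr (x - p) ^+ 2 <= nr (x - u k) ^+ 2 + e' * (2 * nr (x - p) + 2).
  move: tri a1 (nr_ge0 (x - p)) (nr_ge0 (x - u k)) (nr_ge0 (p - u k)) e'0.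
  move: (nr (x - p)) (nr (x - u k)) (nr (p - u k)) e' {e'1 e'2 h1} => a b c e' h h' a0 b0 c0 e'0.
  have [ac|ca] := leP a c; first by nra.
  have : (a - c) ^+ 2 <= b ^+ 2 by rewrite ler_pXn2r ?nnegrE //; lra.
  nra.
move: (k.+1%:R^-1) (e' * _) a2 a3 e'2 t2 => r r' a2 a3 e'2 t2.
have e2 : e = e / 2 + e / 2 :> R by rewrite -splitr.
rewrite e2; move: (e / 2) a2 e'2 => w ? ?; lra.
Qed.

Lemma mkbop V W (f : V -> W) (C : R) :
  (forall (a : R[i]) x y, f (a *: x + y) = a *: f x + f y) ->
  (forall x, nr (f x) <= C * nr x) ->
  exists B : bop V W, forall x, B x = f x.
Proof.
move=> fl fb.
pose fL : {linear V -> W} := HB.pack f (GRing.isLinear.Build _ _ _ _ f fl).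
have fc : continuous fL.
  apply: bounded_linear_continuous; apply/linear_boundedP.
  exists (`|C|%:C); split; first by apply/complex_realP; exists `|C|.
  move=> r hr x; rewrite /= !nrE; apply: le_trans (_ : (C * nr x)%:C <= _).
    by rewrite lecR.
  rewrite rmorphM /=; apply: ler_wpM2r; first by rewrite ler0c nr_ge0.
  by apply: le_trans (ltW hr); rewrite lecR ler_norm.
by exists (Bop fc).
Qed.

Lemma bopP V W (A : bop V W) : exists2 C : R, 0 <= C & forall x, nr (A x) <= C * nr x.
Proof.
have [k /gt0_complex[c c0 ->] hk] := linear_lipschitz (@bop_cont _ _ _ A).
by exists c; [exact: ltW|move=> x; have := hk x; rewrite !nrE -rmorphM lecR].
Qed.

(** The representer is a multiple of a vector [q] orthogonal to the kernel of [f]; the scalar comes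
    from pairing [q] with [f z *: q - f q *: z], which lies in that kernel. *)
Lemma riesz V (f : V -> R[i]) (C : R) :
  (forall (a : R[i]) x y, f (a *: x + y) = a * f x + f y) ->
  (forall x, nr (f x) <= C * nr x) ->
  exists y, forall x, f x = inner x y.
Proof.
move=> fl fb; pose M := [set x | f x = 0].
have f0 : f 0 = 0.
  by have := fl 1 0 0; rewrite scaler0 mul1r addr0 => /esym/(canRL (addrK _)); rewrite subrr.
have fZ a x : f (a *: x) = a * f x by have := fl a x 0; rewrite !addr0 f0 addr0.
have fD x y : f (x + y) = f x + f y by have := fl 1 x y; rewrite scale1r mul1r.
have cM : is_closed_subspace M.
  split=> [|//|x y Mx My|a x Mx]; rewrite /M /=.
  - apply: closedP => p hp; apply: nr_small => e e0.
    have C1 : 0 < `|C| + 1 by rewrite ltr_wpDl.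
    have [m Mm pm] := hp _ (divr_gt0 e0 C1).
    have -> : f p = f (p - m) by rewrite fD -scaleN1r fZ Mm mulr0 addr0.
    apply: le_trans (fb _) _; move: pm; rewrite ler_pdivlMr // => pm.
    have := nr_ge0 (p - m); have := ler_norm C; nra.
  - by rewrite fD Mx My addr0.
  - by rewrite fZ Mx mulr0.
have [[x fx]|nx] := pselect (exists x, f x <> 0); last first.
  exists 0 => x; rewrite inner0r; apply: contrapT => fx; apply: nx; by exists x.
have [p Mp hp] := projection x cM.
set q := x - p; have fq : f q = f x by rewrite fD -scaleN1r fZ Mp mulr0 addr0.
have q0 : inner q q != 0.
  by apply/eqP => /inner_eq0 q0; apply: fx; rewrite -fq q0 f0.
exists (cj (f q / inner q q) *: q) => z; rewrite innerZr' cjK.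
have : inner q (f z *: q - f q *: z) = 0.
  by apply: hp; rewrite /M /= fD -scaleN1r scalerA !fZ; ring.
move=> h; have : inner (f z *: q - f q *: z) q = 0 by rewrite inner_cj h cj0.
rewrite innerBl !innerZl => /eqP; rewrite subr_eq0 => /eqP e.
by rewrite mulrAC -e mulfK.
Qed.

Lemma adj_ex V W (A : bop V W) :
  exists B : bop W V, forall x y, inner (A x) y = inner x (B y).
Proof.
have [C C0 hC] := bopP A.
have h y : exists z, forall x, inner (A x) y = inner x z.
  apply: (@riesz _ _ (C * nr y)) => [a u v|x].
    by rewrite linearP innerDl innerZl.
  apply: le_trans (cauchy_schwarz _ _) _.
  by rewrite mulrAC ler_wpM2r ?nr_ge0.
have [f hf] := choice h.
have [||B hB] := @mkbop _ _ f C.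
- move=> a u v; apply: inner_ext => x; rewrite innerDl innerZl.
  rewrite ![inner (f _) _]inner_cj -!hf innerDr innerZr'.
  by rewrite cjD cjM cjK.
- move=> x; have [->|fx0] := eqVneq (f x) 0; first by rewrite nr0 mulr_ge0 ?nr_ge0.
  have fx : 0 < nr (f x) by rewrite lt_neqAle eq_sym nr_eq0 fx0 nr_ge0.
  rewrite -(ler_pM2r fx) -expr2 nr_sqE -hf.
  apply: le_trans (nr_Re _) _; apply: le_trans (cauchy_schwarz _ _) _.
  by rewrite mulrAC ler_wpM2r ?nr_ge0.
by exists B => x y; rewrite hB hf.
Qed.

Definition adj V W (A : bop V W) : bop W V := sval (cid (adj_ex A)).

Lemma adjP V W (A : bop V W) x y : inner (A x) y = inner x (adj A y).
Proof. exact: (svalP (cid (adj_ex A))). Qed.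

Lemma adjPl V W (A : bop V W) x y : inner (adj A x) y = inner x (A y).
Proof. by rewrite inner_cj -adjP -inner_cj. Qed.

Lemma adjK V W (A : bop V W) x : adj (adj A) x = A x.
Proof. by apply: inner_ext => z; rewrite adjPl -adjP. Qed.

End Hilbert.

(** * Total families and extension of operators *)

Section Span.
Variable R : realType.
Implicit Types V W : hilbertType R.

Definition comb V (I : Type) (s : I -> V) (l : seq (R[i] * I)) : V :=
  \sum_(p <- l) p.1 *: s p.2.

Definition cspan V (I : Type) (s : I -> V) : set V :=
  [set p | forall e : R, 0 < e -> exists l, nr (p - comb s l) <= e].

Definition total V (I : Type) (s : I -> V) : Prop :=
  forall x, (forall i, inner x (s i) = 0) -> x = 0.

Lemma comb_cat V (I : Type) (s : I -> V) l l' : comb s (l ++ l') = comb s l + comb s l'.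
Proof. by rewrite /comb big_cat. Qed.

Lemma comb_scale V (I : Type) (s : I -> V) (a : R[i]) l :
  comb s [seq (a * p.1, p.2) | p <- l] = a *: comb s l.
Proof. by rewrite /comb big_map scaler_sumr; apply: eq_bigr => p _; rewrite scalerA. Qed.

Lemma comb1 V (I : Type) (s : I -> V) i : comb s [:: (1, i)] = s i.
Proof. by rewrite /comb big_seq1 scale1r. Qed.

Lemma linear_comb V W (A : bop V W) (I : Type) (s : I -> V) l :
  A (comb s l) = comb (fun i => A (s i)) l.
Proof. by rewrite /comb linear_sum; apply: eq_bigr => p _; rewrite linearZ. Qed.

Lemma cspan_closed V (I : Type) (s : I -> V) : is_closed_subspace (cspan s).
Proof.
split=> [||x y sx sy e e0|a x sx e e0].
- apply: closedP => p hp e e0; have e20 : 0 < e / 2 by lra.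
  have [m /(_ _ e20)[l hl] pm] := hp _ e20; exists l.
  rewrite -(subrKA m); apply: le_trans (nrD _ _) _; lra.
- by move=> e e0; exists [::]; rewrite /comb big_nil subrr nr0 ltW.
- have e20 : 0 < e / 2 by lra.
  have [l hl] := sx _ e20; have [l' hl'] := sy _ e20.
  exists (l ++ l'); rewrite comb_cat opprD addrACA.
  apply: le_trans (nrD _ _) _; lra.
- have a0 : 0 < nr a + 1 by rewrite ltr_wpDl ?nr_ge0.
  have [l hl] := sx _ (divr_gt0 e0 a0).
  exists [seq (a * p.1, p.2) | p <- l]; rewrite comb_scale -scalerBr nrZ.
  move: hl; rewrite ler_pdivlMr // => hl.
  have := nr_ge0 a; have := nr_ge0 (x - comb s l); nra.
Qed.

Lemma cspan_in V (I : Type) (s : I -> V) i : cspan s (s i).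
Proof. by move=> e e0; exists [:: (1, i)]; rewrite comb1 subrr nr0 ltW. Qed.

Lemma comb_in V (P : set V) (I : Type) (s : I -> V) l :
  is_closed_subspace P -> (forall i, P (s i)) -> P (comb s l).
Proof.
move=> [_ P0 PD PZ] sP; rewrite /comb.
by apply: (big_ind P) => // p _; apply: PZ.
Qed.

Lemma cspan_min V (P : set V) (I : Type) (s : I -> V) :
  is_closed_subspace P -> (forall i, P (s i)) -> cspan s `<=` P.
Proof.
move=> cP sP p hp; have [cP' _ _ _] := cP; apply: (closed_lim cP') => e /hp[l hl].
by exists (comb s l) => //; exact: comb_in.
Qed.

Lemma bop_closed V W (A : bop V W) (P : set W) :
  is_closed_subspace P -> is_closed_subspace [set x | P (A x)].
Proof.
move=> [cP P0 PD PZ]; split=> [||x y Px Py|a x Px] /=.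
- apply: closedP => p hp; apply: (closed_lim cP) => e e0.
  have [C C0 hC] := bopP A; have C1 : 0 < C + 1 by lra.
  have [m Pm pm] := hp _ (divr_gt0 e0 C1); exists (A m) => //.
  rewrite -linearB; apply: le_trans (hC _) _; move: pm; rewrite ler_pdivlMr //.
  have := nr_ge0 (p - m); nra.
- by rewrite linear0.
- by rewrite linearD; exact: PD.
- by rewrite linearZ; exact: PZ.
Qed.

Lemma orth_closed V (x : V) : is_closed_subspace [set p | inner x p = 0].
Proof.
split=> [||u v /= hu hv|a u /= hu].
- apply: closedP => p hp; apply: nr_small => e e0.
  have C1 : 0 < nr x + 1 by rewrite ltr_wpDl ?nr_ge0.
  have [m /= Pm pm] := hp _ (divr_gt0 e0 C1).
  have -> : inner x p = inner x (p - m) by rewrite innerBr Pm subr0.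
  apply: le_trans (cauchy_schwarz _ _) _; move: pm; rewrite ler_pdivlMr //.
  have := nr_ge0 (p - m); have := nr_ge0 x; nra.
- by rewrite /= inner0r.
- by rewrite innerDr hu hv addr0.
- by rewrite innerZr' hu mulr0.
Qed.

Lemma orth_cspan V (I : Type) (s : I -> V) x :
  (forall i, inner x (s i) = 0) -> forall p, cspan s p -> inner x p = 0.
Proof. by move=> h p; apply: (cspan_min (orth_closed x)). Qed.

Lemma total_subspace V (P : set V) (I : Type) (s : I -> V) :
  total s -> is_closed_subspace P -> (forall i, P (s i)) -> forall x, P x.
Proof.
move=> ts cP sP x; have [p Pp hp] := projection x cP.
suff /eqP : x - p = 0 by rewrite subr_eq0 => /eqP ->.
by apply: ts => i; apply: hp.
Qed.

Lemma total_approx V (I : Type) (s : I -> V) : total s ->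
  forall x (e : R), 0 < e -> exists l, nr (x - comb s l) <= e.
Proof.
by move=> ts x; apply: (total_subspace ts (cspan_closed s)); apply: cspan_in.
Qed.

Lemma bop_ext V W (A B : bop V W) (I : Type) (s : I -> V) :
  total s -> (forall i, A (s i) = B (s i)) -> forall x, A x = B x.
Proof.
move=> ts h x; apply: inner_ext => y; rewrite !adjP.
suff /eqP : adj A y - adj B y = 0 by rewrite subr_eq0 => /eqP ->.
apply: ts => i; rewrite innerBl !adjPl h; exact: subrr.
Qed.

Lemma bcomp_ex U V W (A : bop V W) (B : bop U V) : exists C : bop U W, forall x, C x = A (B x).
Proof.
have [a a0 ha] := bopP A; have [b b0 hb] := bopP B.
apply: (@mkbop _ _ _ _ (a * b)) => [c x y|x]; first by rewrite !linearP.
by apply: le_trans (ha _) _; rewrite -mulrA ler_wpM2l.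
Qed.

Definition bcomp U V W (A : bop V W) (B : bop U V) : bop U W := sval (cid (bcomp_ex A B)).

Lemma bcompE U V W (A : bop V W) (B : bop U V) x : bcomp A B x = A (B x).
Proof. exact: (svalP (cid (bcomp_ex A B))). Qed.

Lemma badd_ex V W (A B : bop V W) : exists C : bop V W, forall x, C x = A x + B x.
Proof.
have [a a0 ha] := bopP A; have [b b0 hb] := bopP B.
apply: (@mkbop _ _ _ _ (a + b)) => [c x y|x].
  by rewrite !linearP scalerDr addrACA.
by apply: le_trans (nrD _ _) _; rewrite mulrDl lerD.
Qed.

Definition badd V W (A B : bop V W) : bop V W := sval (cid (badd_ex A B)).

Lemma baddE V W (A B : bop V W) x : badd A B x = A x + B x.
Proof. exact: (svalP (cid (badd_ex A B))). Qed.

Lemma bscale_ex V W (k : R[i]) (A : bop V W) : exists C : bop V W, forall x, C x = k *: A x.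
Proof.
have [a a0 ha] := bopP A.
apply: (@mkbop _ _ _ _ (nr k * a)) => [c x y|x].
  by rewrite linearP scalerDr !scalerA (mulrC k).
by rewrite nrZ -mulrA ler_wpM2l ?nr_ge0.
Qed.

Definition bscale V W (k : R[i]) (A : bop V W) : bop V W := sval (cid (bscale_ex k A)).

Lemma bscaleE V W (k : R[i]) (A : bop V W) x : bscale k A x = k *: A x.
Proof. exact: (svalP (cid (bscale_ex k A))). Qed.

Definition bsub V W (A B : bop V W) : bop V W := badd A (bscale (-1) B).

Lemma bsubE V W (A B : bop V W) x : bsub A B x = A x - B x.
Proof. by rewrite baddE bscaleE scaleN1r. Qed.

Definition bsum V W n (A : 'I_n -> bop V W) : bop V W := \big[@badd V W/@bop0 R V W]_j A j.

Lemma bsumE V W n (A : 'I_n -> bop V W) x : bsum A x = \sum_j A j x.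
Proof.
by rewrite /bsum; apply: (big_morph (fun B : bop V W => B x)) => // B C; rewrite baddE.
Qed.

(** [G] is the closure of the graph of [s i |-> u i] on combinations. The bound alone makes it
    single-valued, so relations among the [s i] need no separate treatment; totality and
    completeness make its domain all of [V]. *)
Lemma extension V W (I : Type) (s : I -> V) (u : I -> W) (C : R) :
  total s -> 0 <= C -> (forall l, nr (comb u l) <= C * nr (comb s l)) ->
  exists B : bop V W, (forall i, B (s i) = u i) /\ forall x, nr (B x) <= C * nr x.
Proof.
move=> ts C0 hC.
have combB (l l' : seq (R[i] * I)) (H : hilbertType R) (t : I -> H) :
    comb t (l ++ [seq (-1 * p.1, p.2) | p <- l']) = comb t l - comb t l'.
  by rewrite comb_cat comb_scale scaleN1r.
pose G x y := forall e : R, 0 < e -> exists l, nr (x - comb s l) <= e /\ nr (y - comb u l) <= e.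
have Gb x y : G x y -> nr y <= C * nr x.
  move=> g; apply/ler_addgt0Pr => e e0; have C1 : 0 < C + 1 by lra.
  have [l [xl yl]] := g _ (divr_gt0 e0 C1).
  have h1 : nr y <= nr (y - comb u l) + nr (comb u l).
    by rewrite -[X in nr X <= _](subrK (comb u l) y); exact: nrD.
  have h2 : nr (comb s l) <= nr (x - comb s l) + nr x.
    rewrite nrB -[X in nr X <= _](subrK x (comb s l)); exact: nrD.
  have := hC l; move: xl yl; rewrite !ler_pdivlMr // => xl yl; nra.
have Glin (a : R[i]) x y x' y' : G x y -> G x' y' -> G (a *: x + x') (a *: y + y').
  move=> g g' e e0; have a0 : 0 < nr a + 1 by rewrite ltr_wpDl ?nr_ge0.
  have e'0 : 0 < e / (nr a + 1) by rewrite divr_gt0.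
  have [l [xl yl]] := g _ e'0; have [l' [xl' yl']] := g' _ e'0.
  exists ([seq (a * p.1, p.2) | p <- l] ++ l'); rewrite !comb_cat !comb_scale.
  have gen (H : hilbertType R) (z z' w w' : H) : nr (z - w) <= e / (nr a + 1) ->
      nr (z' - w') <= e / (nr a + 1) -> nr (a *: z + z' - (a *: w + w')) <= e.
    rewrite opprD addrACA -scalerBr => h h'.
    apply: le_trans (nrD _ _) _; rewrite nrZ.
    move: h h'; rewrite !ler_pdivlMr // => h h'.
    have := nr_ge0 a; have := nr_ge0 (z' - w'); have := nr_ge0 (z - w).
    move: (nr a) (nr (z' - w')) (nr (z - w)) a0 h h' => p q r p1 h h' ? ? ?.
    rewrite -(ler_pM2r p1 _ e); nra.
  by split; exact: gen.
have Gex x : exists y, G x y.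
  have k0 (k : nat) : 0 < k.+1%:R^-1 :> R by rewrite invr_gt0.
  have [f hf] := choice (fun k => total_approx ts x (k0 k)).
  have vC m n : nr (comb u (f m) - comb u (f n)) <= C * (m.+1%:R^-1 + n.+1%:R^-1).
    rewrite -combB; apply: le_trans (hC _) _; rewrite combB ler_wpM2l //.
    rewrite -(subrKA x); apply: le_trans (nrD _ _) _.
    by rewrite (nrB _ x) lerD.
  have C1 : 0 < C + 1 by lra.
  have C2 : 0 < 2 * (C + 1) by lra.
  have [|y hy] := @hilbert_complete _ W (fun k => comb u (f k)).
    move=> e e0; have [N hN] := inv_small (divr_gt0 e0 C2).
    exists N => m n /hN h1 /hN h2; apply: le_trans (vC _ _) _.
    move: h1 h2; rewrite !ler_pdivlMr //.
    have := ltW (k0 m); have := ltW (k0 n).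
    move: (m.+1%:R^-1) (n.+1%:R^-1) => a b; nra.
  exists y => e e0; have [N1 h1] := inv_small e0; have [N2 h2] := hy _ e0.
  exists (f (maxn N1 N2)); split; last by apply: h2; rewrite leq_maxr.
  by apply: le_trans (hf _) _; apply: h1; rewrite leq_maxl.
have Guniq x y y' : G x y -> G x y' -> y = y'.
  move=> g g'; have := Glin (-1) _ _ _ _ g g'; rewrite !scaleN1r addNr => /Gb.
  rewrite nr0 mulr0 => h; apply/esym/eqP; rewrite -subr_eq0 addrC -nr_eq0.
  by rewrite eq_le h nr_ge0.
have [f hf] := choice Gex.
have [||B hB] := @mkbop _ _ _ f C.
- by move=> a x y; apply: Guniq (hf _) _; apply: Glin.
- by move=> x; apply: Gb.
exists B; split=> [i|x]; rewrite hB; last exact: Gb.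
apply: (Guniq (s i)) => // e e0; exists [:: (1, i)].
by rewrite !comb1 !subrr !nr0 ltW.
Qed.

Lemma comb_norm V W (I : Type) (s : I -> V) (u : I -> W) (c : R) :
  0 <= c -> (forall i j, inner (u i) (u j) = c%:C * inner (s i) (s j)) ->
  forall l, nr (comb u l) <= Num.sqrt c * nr (comb s l).
Proof.
move=> c0 h l; apply: ler_sq; first by rewrite mulr_ge0 ?sqrtr_ge0 ?nr_ge0.
rewrite exprMn sqr_sqrtr // !nr_sqE /comb !inner_suml.
have -> : \sum_(i <- l) inner (i.1 *: u i.2) (\sum_(p <- l) p.1 *: u p.2) =
    c%:C * \sum_(i <- l) inner (i.1 *: s i.2) (\sum_(p <- l) p.1 *: s p.2).
  rewrite mulr_sumr; apply: eq_bigr => p _; rewrite !inner_sumr mulr_sumr.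
  by apply: eq_bigr => q _; rewrite !innerZl !innerZr' h; ring.
by case: (\sum_(i <- l) _) => a b; simpc; rewrite lexx.
Qed.

(** The factor [c] admits multiples of isometries, such as [W x] in [self_op_ex], for which [c] is
    [|x|^2]. *)
Lemma extension_iso V W (I : Type) (s : I -> V) (u : I -> W) (c : R) :
  total s -> 0 <= c -> (forall i j, inner (u i) (u j) = c%:C * inner (s i) (s j)) ->
  exists B : bop V W, forall i, B (s i) = u i.
Proof.
move=> ts c0 h; have [B [hB _]] := extension ts (sqrtr_ge0 c) (comb_norm c0 h).
by exists B.
Qed.

Lemma strong_limit V W (A : nat -> bop V W) (C : R) :
  (forall n x, nr (A n x) <= C * nr x) ->
  (forall x (e : R), 0 < e -> exists N, forall m n, (N <= m)%N -> (N <= n)%N ->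
     nr (A m x - A n x) <= e) ->
  exists B : bop V W, forall x (e : R), 0 < e ->
    exists N, forall n, (N <= n)%N -> nr (B x - A n x) <= e.
Proof.
move=> AC hA.
have [f hf] := choice (fun x => hilbert_complete (hA x)).
have [||B hB] := @mkbop _ _ _ f C.
- move=> a x y; apply/eqP; rewrite -subr_eq0; apply/eqP/nr_small => e e0.
  have a0 : 0 < nr a + 2 by have := nr_ge0 a; lra.
  have e'0 : 0 < e / (nr a + 2) by rewrite divr_gt0.
  have [N1 h1] := hf (a *: x + y) _ e'0; have [N2 h2] := hf x _ e'0.
  have [N3 h3] := hf y _ e'0; pose k := maxn N1 (maxn N2 N3).
  have k1 : (N1 <= k)%N by rewrite leq_maxl.
  have k2 : (N2 <= k)%N by rewrite /k maxnCA leq_maxl.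
  have k3 : (N3 <= k)%N by rewrite /k maxnA leq_maxr.
  have -> : f (a *: x + y) - (a *: f x + f y) = f (a *: x + y) - A k (a *: x + y)
     + (- (a *: (f x - A k x)) - (f y - A k y)).
    by rewrite (linearP (A k)); vring.
  apply: le_trans (nrD _ _) _; apply: le_trans (lerD (h1 _ k1) (nrD _ _)) _.
  rewrite !nrN nrZ; have := h2 _ k2; have := h3 _ k3; rewrite !ler_pdivlMr //.
  have -> : e / (nr a + 2) + (nr a * nr (f x - A k x) + nr (f y - A k y)) <= e =
     (e + (nr a * nr (f x - A k x) + nr (f y - A k y)) * (nr a + 2) <= e * (nr a + 2)).
    by rewrite -(ler_pM2r a0) mulrDl divfK // gt_eqF.
  have := nr_ge0 a; have := nr_ge0 (f x - A k x); have := nr_ge0 (f y - A k y).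
  move: (nr a) (nr (f x - _)) (nr (f y - _)) => p q r; nra.
- move=> x; apply/ler_addgt0Pl => e e0; have [N hN] := hf x _ e0.
  rewrite -[X in nr X <= _](subrK (A N x)).
  by apply: le_trans (nrD _ _) _; rewrite lerD ?hN.
by exists B => x e /hf; rewrite hB.
Qed.

Lemma neumann V (Z : bop V V) (q : R) :
  0 <= q < 1 -> (forall x, nr (Z x) <= q * nr x) ->
  forall y, exists h, h = y + Z h.
Proof.
move=> /andP[q0 q1] hZ y; pose u := fix u n := if n is m.+1 then y + Z (u m) else 0.
have p0 : 0 < 1 - q by lra.
have ub k : nr (u k) <= nr y / (1 - q).
  rewrite ler_pdivlMr //; elim: k => [|k IH]; first by rewrite nr0 mul0r nr_ge0.
  have := nrD y (Z (u k)); have := hZ (u k); rewrite -/(u k.+1).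
  have := nr_ge0 (u k); move: IH; set a := nr (u k); set b := nr (u k.+1).
  move=> IH a0 h1 h2; have : b <= nr y + q * a by lra.
  nra.
(* [u (n + k) - u n] is [Z^n (u k)]: each further step applies [Z] to the difference. *)
have ud n k : nr (u (n + k)%N - u n) <= q ^+ n * (nr y / (1 - q)).
  elim: n => [|n IH]; first by rewrite subr0 expr0 mul1r.
  rewrite addSn /= opprD addrACA subrr add0r -linearB.
  apply: le_trans (hZ _) _; by rewrite exprS -mulrA ler_wpM2l.
have small (e : R) : 0 < e -> exists N, q ^+ N * (nr y / (1 - q)) <= e.
  move=> e0; set c := _ / _; have c0 : 0 <= c by rewrite divr_ge0 ?nr_ge0 ?ltW.
  have e1 : 0 < e / (c + 1) by rewrite divr_gt0 // ltr_wpDl.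
  have qn : `|q| < 1 by rewrite ger0_norm.
  have /cvgrPdist_lt /(_ _ e1)[N _ /(_ N (leqnn N)) /=] := cvg_expr qn.
  rewrite sub0r normrN ger0_norm ?exprn_ge0 // ltr_pdivlMr ?ltr_wpDl // => h.
  exists N; have := exprn_ge0 N q0; nra.
have [|h hh] := @hilbert_complete _ V u.
  move=> e e0; have e20 : 0 < e / 2 by lra.
  have [N hN] := small _ e20; exists N => m n Nm Nn.
  rewrite -(subrKA (u N)); apply: le_trans (nrD _ _) _.
  rewrite (nrB (u N)) -(subnKC Nm) -(subnKC Nn).
  have := ud N (m - N)%N; have := ud N (n - N)%N; lra.
exists h; apply/eqP; rewrite -subr_eq0; apply/eqP/nr_small => e e0.
have e20 : 0 < e / 2 by lra.
have [N hN] := hh _ e20.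
have -> : h - (y + Z h) = (h - u N.+1) - Z (h - u N).
  by rewrite linearB /=; vring.
apply: le_trans (nrD _ _) _; rewrite nrN.
have := hN _ (leqnn N); have := hN _ (leqnSn N); have := hZ (h - u N).
have := nr_ge0 (h - u N); nra.
Qed.

Lemma proj_ex V (M : set V) : is_closed_subspace M ->
  exists P : bop V V, (forall x, M (P x)) /\ forall x m, M m -> inner (x - P x) m = 0.
Proof.
move=> cM; have [_ M0 MD MZ] := cM.
have h x : exists p, M p /\ forall m, M m -> inner (x - p) m = 0.
  by have [p ? ?] := projection x cM; exists p.
have [f hf] := choice h.
have MB u v : M u -> M v -> M (u - v).
  by move=> Mu Mv; rewrite -scaleN1r; apply: MD => //; apply: MZ.
have [||P hP] := @mkbop _ _ _ f 1.
- move=> a x y; apply/eqP; rewrite -subr_eq0; apply/eqP/inner_eq0.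
  set d := f _ - _.
  have Md : M d by apply: MB; [exact: (hf _).1|apply: MD; [apply: MZ|]; exact: (hf _).1].
  have -> : d = a *: (x - f x) + (y - f y) - (a *: x + y - f (a *: x + y)).
    by rewrite /d; vring.
  rewrite innerBl innerDl innerZl.
  have -> : a *: (x - f x) + (y - f y) - (a *: x + y - f (a *: x + y)) = d.
    by rewrite /d; vring.
  by rewrite !(hf _).2 // mulr0 addr0 subr0.
- move=> x; rewrite mul1r; apply: ler_sq; first exact: nr_ge0.
  rewrite -[X in _ <= nr X ^+ 2](subrK (f x)) pythagoras ?lerDr ?sqr_ge0 //.
  by apply: (hf _).2; exact: (hf _).1.
by exists P; split=> [x|x m Mm]; rewrite hP; [exact: (hf _).1|exact: (hf _).2].
Qed.

(** Douglas factorization: [C] is [Q x |-> S x] on the range of [Q] and [0] on its orthogonal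
    complement. Combinations of the total family [s] split into some [Q X] plus a vector orthogonal
    to the range, and Pythagoras gives the bound. *)
Lemma douglas V W U (Q : bop V W) (S : bop V U) :
  (forall x, nr (S x) <= nr (Q x)) ->
  exists C : bop W U, (forall x, C (Q x) = S x) /\ forall x, nr (C x) <= nr x.
Proof.
move=> h.
have [P [PM hP]] := proj_ex (cspan_closed Q).
pose s (i : V + W) := match i with inl x => Q x | inr z => z - P z end.
pose u (i : V + W) : U := match i with inl x => S x | inr z => 0 end.
have ts : total s.
  move=> w hw; apply: inner_eq0.
  have h1 : inner w (P w) = 0.
    by apply: (orth_cspan (s := Q)) => // x; exact: (hw (inl x)).
  by have := hw (inr w); rewrite innerBr h1 subr0.
have hc (l : seq (R[i] * (V + W))) : exists X Z, [/\ comb s l = Q X + Z, comb u l = S X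
    & forall x, inner (Q x) Z = 0].
  elim: l => [|[a [x|z]] l [X [Z [h1 h2 h3]]]].
  - by exists 0, 0; rewrite /comb !big_nil !linear0 addr0; split=> // x; rewrite inner0r.
  - exists (a *: x + X), Z; split=> //.
      by rewrite /comb big_cons -/(comb s l) h1 linearP addrA.
    by rewrite /comb big_cons -/(comb u l) h2 linearP.
  - exists X, (a *: (z - P z) + Z); split=> [||x].
    + by rewrite /comb big_cons -/(comb s l) h1 addrCA.
    + by rewrite /comb big_cons -/(comb u l) h2 scaler0 add0r.
    + rewrite innerDr innerZr' h3 inner_cj hP ?cj0 ?mulr0 ?addr0 //.
      exact: cspan_in.
have [||C [hC Cb]] := @extension _ _ _ s u 1 ts.
- by rewrite ler01.
- move=> l; have [X [Z [-> -> h3]]] := hc l; rewrite mul1r.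
  apply: le_trans (h X) _; apply: ler_sq; first exact: nr_ge0.
  by rewrite pythagoras ?lerDl ?sqr_ge0.
exists C; split=> x; first exact: (hC (inl x)).
by have := Cb x; rewrite mul1r.
Qed.

End Span.

(** * Operators on tensor products *)

Section TensorOps.
Variable R : realType.
Implicit Types H F : hilbertType R.

Lemma total_ext (V : hilbertType R) (I : Type) (s : I -> V) (x y : V) :
  total s -> (forall i, inner x (s i) = inner y (s i)) -> x = y.
Proof.
move=> ts h; apply/eqP; rewrite -subr_eq0; apply/eqP/ts => i.
by rewrite innerBl h subrr.
Qed.

Lemma dense_total (V : hilbertType R) (I : Type) (s : I -> V) (S : set V) :
  dense (lin_span S) -> (forall v, S v -> exists i, v = s i) -> total s.
Proof.
move=> dS hS x hx.
have : inner x x = 0.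
  apply/eqP; rewrite -nr_eq0; apply/eqP/le_anti; rewrite nr_ge0 andbT.
  apply/ler_addgt0Pl => e e0; rewrite addr0.
  have x1 : 0 < nr x + 1 by rewrite ltr_wpDl ?nr_ge0.
  have e1 : (0 : R[i]) < (e / (nr x + 1))%:C by rewrite ltcR divr_gt0.
  have [v [N [a [t [tS ->]]]]] := (hilbert_denseP _).1 dS x _ e1.
  rewrite nrE ltcR => hv.
  have -> : inner x x = inner x (x - \sum_(l < N) a l *: t l).
    rewrite innerBr inner_sumr big1 ?subr0 // => l _.
    by have [i ->] := hS _ (tS l); rewrite innerZr' hx mulr0.
  apply: le_trans (cauchy_schwarz _ _) _; move: hv; rewrite ltr_pdivlMr //.
  have := nr_ge0 x; have := nr_ge0 (x - \sum_(l < N) a l *: t l); nra.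
exact: inner_eq0.
Qed.

Lemma total_dense (V : hilbertType R) (I : Type) (s : I -> V) (S : set V) :
  total s -> (forall i, S (s i)) -> dense (lin_span S).
Proof.
move=> ts hS; apply/hilbert_denseP => x e e0.
have [e' e'0 ->] := gt0_complex e0.
have [l hl] := total_approx ts x (divr_gt0 e'0 (ltr0n _ 2)).
exists (comb s l); last by rewrite nrE ltcR; lra.
rewrite /comb; apply: (big_ind (lin_span S)).
- exact: lin_span0.
- by move=> u v; apply: lin_spanD.
- by move=> p _; apply/lin_spanZ/lin_span_sub.
Qed.

Section One.
Variables (H F : hilbertType R) (T : tensor2 H F).

Definition elem (p : H * F) : T := tens2 T p.1 p.2.

Lemma elem_total : total elem.
Proof.
apply: (dense_total (@tens2_dense _ _ _ T)) => v [x [y ->]].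
by exists (x, y).
Qed.

Lemma nr_tens2 x y : nr (tens2 T x y) = nr x * nr y.
Proof. by apply: (@complexI R); rewrite rmorphM /= -!nrE tens2_norm. Qed.

Lemma tensr_ex x : exists B : bop F T, forall y, B y = tens2 T x y.
Proof.
apply: (@mkbop _ _ _ _ (nr x)) => [a y z|y]; first by rewrite tens2Dr tens2Zr.
by rewrite nr_tens2.
Qed.

Definition tensr x : bop F T := sval (cid (tensr_ex x)).

Lemma tensrE x y : tensr x y = tens2 T x y.
Proof. exact: (svalP (cid (tensr_ex x))). Qed.

Lemma tensl_ex y : exists B : bop H T, forall x, B x = tens2 T x y.
Proof.
apply: (@mkbop _ _ _ _ (nr y)) => [a x z|x]; first by rewrite tens2Dl tens2Zl.
by rewrite nr_tens2 mulrC.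
Qed.

Definition tensl y : bop H T := sval (cid (tensl_ex y)).

Lemma tenslE y x : tensl y x = tens2 T x y.
Proof. exact: (svalP (cid (tensl_ex y))). Qed.

Lemma adj_tensr x x' y : adj (tensr x) (tens2 T x' y) = inner x' x *: y.
Proof. by apply: inner_ext => z; rewrite adjPl tensrE tens2_inner innerZl. Qed.

Lemma tens2_total (I J : Type) (s : I -> H) (t : J -> F) : total s -> total t ->
  total (fun p : I * J => tens2 T (s p.1) (t p.2)).
Proof.
move=> ts tt z hz; apply: elem_total => -[x y] /=.
have h j : inner z (tens2 T x (t j)) = 0.
  rewrite -tenslE; move: x {y}.
  apply: (total_subspace ts (bop_closed (tensl (t j)) (orth_closed z))) => i.
  by rewrite /= tenslE (hz (i, j)).
rewrite /elem /= -tensrE; move: y.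
apply: (total_subspace tt (bop_closed (tensr x) (orth_closed z))) => j.
by rewrite /= tensrE.
Qed.

Lemma tswap_dense : dense (lin_span [set v | exists y x, v = tens2 T x y]).
Proof. by apply: (total_dense elem_total) => -[x y]; exists y, x. Qed.

(** The carrier stays [T], so that results on [A (x) I] become results on [I (x) A] for the same
    space. *)
Definition tswap : tensor2 F H :=
  @Tensor2 R F H T (fun y x => tens2 T x y)
    (fun y y' x x' => etrans (tens2_inner T x x' y y') (mulrC _ _)) tswap_dense.

End One.

(* Splitting off the component of every second factor along the first one
   reduces the number of terms by one. *)
Lemma tens_bound H H' F (T : tensor2 H F) (T' : tensor2 H' F) (A : bop H H') (C : R) :
  0 <= C -> (forall x, nr (A x) <= C * nr x) ->
  forall l : seq (H * F),
    nr (\sum_(p <- l) tens2 T' (A p.1) p.2) <= C * nr (\sum_(p <- l) tens2 T p.1 p.2).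
Proof.
move=> C0 hA l; have [m] := ubnP (size l); elim: m l => // m IH [|[x y] l] /= hl.
  by rewrite !big_nil !nr0 mulr0.
rewrite !big_cons /=.
have [->|y0] := eqVneq y 0.
  by rewrite -!tensrE !linear0 !add0r; apply: IH.
have yy : inner y y != 0 by apply: contra_neq y0 => /inner_eq0.
pose c (z : F) : R[i] := inner z y / inner y y.
pose l' := [seq (p.1, p.2 - c p.2 *: y) | p <- l].
pose X := x + \sum_(p <- l) c p.2 *: p.1.
have split_ (G : hilbertType R) (TG : tensor2 G F) (B : bop H G) :
    tens2 TG (B x) y + \sum_(p <- l) tens2 TG (B p.1) p.2 =
    tens2 TG (B X) y + \sum_(p <- l') tens2 TG (B p.1) p.2.
  rewrite big_map /= /X linearD tens2Dl -addrA; congr (_ + _).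
  rewrite linear_sum -tenslE linear_sum -big_split /=; apply: eq_bigr => p _.
  rewrite tenslE linearZ tens2Zl -tens2Zr -tens2Dr; congr tens2.
  by rewrite addrC subrK.
have orth (G : hilbertType R) (TG : tensor2 G F) (B : bop H G) :
    inner (tens2 TG (B X) y) (\sum_(p <- l') tens2 TG (B p.1) p.2) = 0.
  rewrite inner_sumr big_map big1 // => p _ /=; rewrite tens2_inner inner_cj innerBr.
  rewrite innerZr' (inner_cj p.2 y).
    have -> : inner y y = cj (inner y y) by rewrite -inner_cj.
    by rewrite -cjM /c divfK // subrr mulr0.
have s1 := split_ _ T (bop1 H); rewrite /= in s1; rewrite s1 (split_ _ T' A).
have o1 := orth _ T (bop1 H); rewrite /= in o1.
apply: ler_sq; first by rewrite mulr_ge0 ?nr_ge0.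
rewrite exprMn !pythagoras // !nr_tens2 mulrDr lerD //.
  rewrite !exprMn mulrA ler_wpM2r ?sqr_ge0 // -exprMn.
  by rewrite ler_pXn2r ?nnegrE ?mulr_ge0 ?nr_ge0.
rewrite -exprMn ler_pXn2r ?nnegrE ?mulr_ge0 ?nr_ge0 //.
by apply: IH; rewrite size_map.
Qed.

(** One operator has to inherit every bound of [A], while [extension] fixes its bound in advance;
    the extensions for different bounds coincide because they agree on elementary tensors. *)
Lemma ampl_ex H H' F (T : tensor2 H F) (T' : tensor2 H' F) (A : bop H H') :
  exists B : bop T T', (forall x y, B (tens2 T x y) = tens2 T' (A x) y) /\
    forall C, 0 <= C -> (forall x, nr (A x) <= C * nr x) -> forall t, nr (B t) <= C * nr t.
Proof.
have ex C : 0 <= C -> (forall x, nr (A x) <= C * nr x) ->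
  exists B : bop T T', (forall x y, B (tens2 T x y) = tens2 T' (A x) y) /\
    forall t, nr (B t) <= C * nr t.
  move=> C0 hA.
  pose u (p : H * F) := tens2 T' (A p.1) p.2.
  have hl (G : hilbertType R) (TG : tensor2 G F) (B : bop H G) (l : seq (R[i] * (H * F))) :
      comb (fun p => tens2 TG (B p.1) p.2) l =
      \sum_(q <- [seq (p.1 *: p.2.1, p.2.2) | p <- l]) tens2 TG (B q.1) q.2.
    by rewrite /comb big_map; apply: eq_bigr => p _; rewrite linearZ tens2Zl.
  have [|B [hB Bb]] := @extension _ _ _ _ (elem T) u C (@elem_total _ _ T) C0.
    by move=> l; rewrite (hl _ _ A) (hl _ _ (bop1 H)); apply: tens_bound.
  by exists B; split=> // x y; have := hB (x, y).
have [C0 C00 hC0] := bopP A; have [B [hB _]] := ex _ C00 hC0.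
exists B; split=> // C C_0 hC t; have [B' [hB' b']] := ex _ C_0 hC.
by rewrite (bop_ext (@elem_total _ _ T) (A := B) (B := B')) // => -[x y]; rewrite /elem hB hB'.
Qed.

Definition ampl H H' F (T : tensor2 H F) (T' : tensor2 H' F) (A : bop H H') : bop T T' :=
  sval (cid (ampl_ex T T' A)).

Lemma amplE H H' F (T : tensor2 H F) (T' : tensor2 H' F) (A : bop H H') x y :
  ampl T T' A (tens2 T x y) = tens2 T' (A x) y.
Proof. exact: (svalP (cid (ampl_ex T T' A))).1. Qed.

Lemma ampl_bound H H' F (T : tensor2 H F) (T' : tensor2 H' F) (A : bop H H') C :
  0 <= C -> (forall x, nr (A x) <= C * nr x) ->
  forall t, nr (ampl T T' A t) <= C * nr t.
Proof. exact: (svalP (cid (ampl_ex T T' A))).2. Qed.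

Lemma ampl_adj H H' F (T : tensor2 H F) (T' : tensor2 H' F) (A : bop H H') x y :
  adj (ampl T T' A) (tens2 T' x y) = tens2 T (adj A x) y.
Proof.
by apply: (total_ext (@elem_total _ _ T)) => -[x' y'];
  rewrite adjPl /elem amplE !tens2_inner adjPl.
Qed.

Definition ampr H F F' (T : tensor2 H F) (T' : tensor2 H F') (A : bop F F') : bop T T' :=
  ampl (tswap T) (tswap T') A.

Lemma amprE H F F' (T : tensor2 H F) (T' : tensor2 H F') (A : bop F F') x y :
  ampr T T' A (tens2 T x y) = tens2 T' x (A y).
Proof. exact: (amplE (tswap T) (tswap T')). Qed.

Lemma ampr_bound H F F' (T : tensor2 H F) (T' : tensor2 H F') (A : bop F F') C :
  0 <= C -> (forall x, nr (A x) <= C * nr x) ->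
  forall t, nr (ampr T T' A t) <= C * nr t.
Proof. exact: (@ampl_bound _ _ _ (tswap T) (tswap T')). Qed.

Lemma ampr_adj H F F' (T : tensor2 H F) (T' : tensor2 H F') (A : bop F F') x y :
  adj (ampr T T' A) (tens2 T' x y) = tens2 T x (adj A y).
Proof. exact: (ampl_adj (tswap T) (tswap T')). Qed.

End TensorOps.

(** * The shifts on the Drury-Arveson space *)

Section DA.
Variables (R : realType) (n : nat) (H : drury_arveson R n).
Local Notation X := (unit_ball (R := R) (n := n)).

Definition ker (w : X) : H := rk_kernel H w.

Lemma ball0 : unit_ball (0 : 'rV[R[i]]_n).
Proof.
rewrite /unit_ball /= big1 => [|i _]; last by rewrite mxE normr0 expr0n.
exact: ltr01.
Qed.

Definition origin : X := SigSub (mem_set ball0).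

(** The constant function [1]. *)
Definition one : H := ker origin.

Definition zc (w : X) (j : 'I_n) : R[i] := val w ord0 j.

Lemma zc0 j : zc origin j = 0.
Proof. by rewrite /zc /= mxE. Qed.

Lemma inner_ker w z : inner (ker w) (ker z) = (1 - \sum_j zc z j * cj (zc w j))^-1.
Proof. by rewrite -rk_reproducing rk_kernelE. Qed.

Lemma zc_lt1 (w : X) : \sum_j nr (zc w j) ^+ 2 < 1.
Proof.
have := set_valP w; rewrite /unit_ball /=.
have -> : \sum_(i < n) `|set_val w ord0 i| ^+ 2 = (\sum_j nr (zc w j) ^+ 2)%:C.
  by rewrite rmorph_sum; apply: eq_bigr => i _; rewrite /zc nrE -rmorphXn.
by rewrite -[1 in X in X -> _]/(1%:C) ltcR.
Qed.

Lemma kernel_neq0 (w z : X) : 1 - \sum_j zc z j * cj (zc w j) != 0.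
Proof.
rewrite subr_eq0; apply/eqP => h.
have : nr (\sum_j zc z j * cj (zc w j)) < 1.
  apply: le_lt_trans (nr_sum _ _ _) _.
  apply: (@le_lt_trans _ _ ((\sum_j nr (zc z j) ^+ 2 + \sum_j nr (zc w j) ^+ 2) / 2)).
    rewrite -big_split mulr_suml; apply: ler_sum => j _; rewrite nrM nr_cj /=.
    have := sqr_ge0 (nr (zc z j) - nr (zc w j)); lra.
  have := zc_lt1 w; have := zc_lt1 z; lra.
by rewrite -h /nr normr1 ltxx.
Qed.

Lemma inner_kerM w z : (\sum_j zc z j * cj (zc w j)) * inner (ker w) (ker z) =
  inner (ker w) (ker z) - 1.
Proof.
rewrite inner_ker; have := kernel_neq0 w z; set s := \sum_j _ => h.
by rewrite -[X in X * _](subKr 1) mulrBl mul1r divff.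
Qed.

Lemma inner_ker_one w : inner (ker w) one = 1.
Proof.
rewrite inner_ker big1 ?subr0 ?invr1 // => j _; by rewrite zc0 mul0r.
Qed.

Lemma nr_one : nr one = 1.
Proof.
have : nr one ^+ 2 = 1 by rewrite nr_sqE inner_ker_one.
by move=> /eqP; rewrite -[X in _ == X](expr1n _ 2) eqrXn2 ?nr_ge0 // => /eqP.
Qed.

Lemma ker_total : total ker.
Proof.
move=> f hf; apply: (@rk_eval_inj _ _ _ H); apply/funext => w.
by rewrite !rk_reproducing inner0l; exact: hf.
Qed.

(** In each pair of terms this is the kernel identity [<z, w> K = K - 1]. It makes
    [ker w |-> cj (zc w j) *: ker w] a column contraction before these maps are known to extend to
    operators. *)
Lemma row_comb (l : seq (R[i] * X)) :
  \sum_j nr (comb (fun w => cj (zc w j) *: ker w) l) ^+ 2 =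
  nr (comb ker l) ^+ 2 - nr (inner (comb ker l) one) ^+ 2.
Proof.
apply: (@complexI R); rewrite rmorphB rmorph_sum /= -innerxx -cjM_nr -inner_cj.
have -> : inner one (comb ker l) * inner (comb ker l) one =
    \sum_(p <- l) \sum_(q <- l) p.1 * cj q.1.
  rewrite mulrC /comb inner_suml mulr_suml; apply: eq_bigr => p _.
  rewrite inner_sumr mulr_sumr; apply: eq_bigr => q _.
  rewrite innerZl innerZr' inner_ker_one (inner_cj (ker _)) inner_ker_one cj1; ring.
under eq_bigr do rewrite -innerxx /comb inner_suml.
rewrite exchange_big /= /comb inner_suml -sumrB; apply: eq_bigr => p _.
under eq_bigr do rewrite inner_sumr.
rewrite exchange_big /= inner_sumr -sumrB; apply: eq_bigr => q _.
under eq_bigr do rewrite !innerZl !innerZr' cjK.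
rewrite innerZl innerZr'.
transitivity (p.1 * cj q.1 * ((\sum_j zc q.2 j * cj (zc p.2 j)) * inner (ker p.2) (ker q.2))).
  by rewrite mulr_suml mulr_sumr; apply: eq_bigr => j _; ring.
by rewrite inner_kerM; ring.
Qed.

(** The adjoint is built before the shift: the kernel functions are its eigenvectors, so its values
    on a total family are prescribed. *)
Lemma shift_adj_ex j :
  exists B : bop H H, forall w, B (ker w) = cj (zc w j) *: ker w.
Proof.
have [||B [hB _]] := @extension _ _ _ _ ker (fun w => cj (zc w j) *: ker w) 1 ker_total.
- exact: ler01.
- move=> l; rewrite mul1r; apply: ler_sq; first exact: nr_ge0.
  apply: le_trans (_ : \sum_j nr (comb (fun w => cj (zc w j) *: ker w) l) ^+ 2 <= _).
    by rewrite (bigD1 j) //= lerDl sumr_ge0 // => i _; rewrite sqr_ge0.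
  by rewrite row_comb lerBlDr lerDl sqr_ge0.
by exists B.
Qed.

Definition sha j : bop H H := sval (cid (shift_adj_ex j)).

Lemma shaE j w : sha j (ker w) = cj (zc w j) *: ker w.
Proof. exact: (svalP (cid (shift_adj_ex j))). Qed.

Definition sh j : bop H H := adj (sha j).

Lemma sh_eval j f (w : X) : rk_eval (sh j f) w = zc w j * rk_eval f w.
Proof. by rewrite !rk_reproducing /sh adjPl shaE innerZr' cjK. Qed.

Lemma mulop_uniq phi (A B : bop H H) : is_mulop phi A -> is_mulop phi B -> forall f, A f = B f.
Proof. by move=> hA hB f; apply: (@rk_eval_inj _ _ _ H); apply/funext => z; rewrite hA hB. Qed.

Lemma sh_mulop j : is_mulop (fun z => z ord0 j) (sh j).
Proof. by move=> f z; rewrite sh_eval. Qed.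

Lemma coord_mulopE j f : coord_mulop H j f = sh j f.
Proof.
apply: (@mulop_uniq (fun z => z ord0 j)); last exact: sh_mulop.
apply: (@xgetPex _ (bop0 H H) [set A | is_mulop (fun z : 'rV[R[i]]_n => z ord0 j) A]).
by exists (sh j); exact: sh_mulop.
Qed.

Lemma row_identityH x : \sum_j sh j (sha j x) = x - inner x one *: one.
Proof.
have [||K hK] := @mkbop _ _ _ (fun x : H => inner x one *: one) 1.
- by move=> a u v; rewrite innerDl innerZl scalerDl scalerA.
- move=> u; rewrite nrZ nr_one mulr1 mul1r.
  by have := cauchy_schwarz u one; rewrite nr_one mulr1.
have := @bop_ext _ _ _ (bsum (fun j => bcomp (sh j) (sha j))) (bsub (bop1 H) K) _ _ ker_total.
move=> h; have {}h x' := etrans (esym (bsumE _ x')) (h _ x').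
rewrite -hK -[RHS]/(bop1 H x - _) -bsubE -h.
  by apply: eq_bigr => j _; rewrite bcompE.
move=> w; rewrite bsumE bsubE hK /= inner_ker_one scale1r.
apply: (total_ext ker_total) => z.
rewrite inner_suml; under eq_bigr do rewrite bcompE adjPl !shaE innerZl innerZr' cjK mulrA.
rewrite -mulr_suml innerBl [inner one _]inner_cj inner_ker_one cj1 -inner_kerM.
by congr (_ * _); apply: eq_bigr => j _; rewrite mulrC.
Qed.

Lemma row_normH x : \sum_j nr (sha j x) ^+ 2 = nr x ^+ 2 - nr (inner x one) ^+ 2.
Proof.
apply: (@complexI R); rewrite rmorphB rmorph_sum /= -!innerxx -cjM_nr -inner_cj.
have -> : inner one x * inner x one = inner (inner x one *: one) x by rewrite innerZl mulrC.
rewrite -innerBl -row_identityH inner_suml; apply: eq_bigr => j _.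
by rewrite adjPl innerxx.
Qed.

Section Tens.
Variables (F : hilbertType R) (T : tensor2 H F).

(** In the notation of the overview, [adj kap] is [k_0'] and [SA j] is [S_j'], so that the shift
    itself is written [adj (SA j)]. *)
Definition kap : bop F T := tensr T one.
Definition SA j : bop T T := ampl T T (sha j).

Definition kert (p : X * F) : T := tens2 T (ker p.1) p.2.

Lemma kert_total : total kert.
Proof. by apply: (@tens2_total _ _ _ T _ _ ker id ker_total) => x /(_ x)/inner_eq0. Qed.

Lemma SA_kert j w y : SA j (tens2 T (ker w) y) = cj (zc w j) *: tens2 T (ker w) y.
Proof. by rewrite amplE shaE tens2Zl. Qed.

Lemma adj_kap w y : adj kap (tens2 T (ker w) y) = y.
Proof. by rewrite adj_tensr inner_ker_one scale1r. Qed.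

Lemma row_identity x : \sum_j adj (SA j) (SA j x) = x - kap (adj kap x).
Proof.
have := @bop_ext _ _ _ (bsum (fun j => bcomp (adj (SA j)) (SA j)))
  (bsub (bop1 T) (bcomp kap (adj kap))) _ _ (@elem_total _ _ _ T).
move=> h; have {}h x' := etrans (esym (bsumE _ x')) (h _ x').
rewrite -[RHS]/(bop1 T x - _) -(bcompE kap) -bsubE -h.
  by apply: eq_bigr => j _; rewrite bcompE.
move=> [u y]; rewrite bsumE bsubE bcompE /elem /=.
rewrite adj_tensr tensrE tens2Zr -tens2Zl -!tenslE -linearB -row_identityH linear_sum.
by apply: eq_bigr => j _; rewrite bcompE !tenslE amplE ampl_adj.
Qed.

Lemma row_norm x : \sum_j nr (SA j x) ^+ 2 = nr x ^+ 2 - nr (adj kap x) ^+ 2.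
Proof.
apply: (@complexI R); rewrite rmorphB rmorph_sum /= -!innerxx adjPl.
rewrite -innerBr -row_identity inner_sumr; apply: eq_bigr => j _.
by rewrite -innerxx adjP.
Qed.

End Tens.

End DA.

(** * An orthonormal basis of the Drury-Arveson space *)

Section Basis.
Variables (R : realType) (n : nat) (hn : (0 < n)%N) (H : drury_arveson R n).
Local Notation X := (unit_ball (R := R) (n := n)).

Fixpoint monomial (s : seq 'I_n) : H := if s is j :: s' then sh H j (monomial s') else one H.

Lemma ker_fix (w : X) : ker H w = one H + \sum_j cj (zc w j) *: sh H j (ker H w).
Proof.
apply: (total_ext (@ker_total _ _ H)) => z; rewrite innerDl inner_suml.
rewrite [inner (one H) _]inner_cj inner_ker_one cj1.
apply/eqP; rewrite addrC -subr_eq -inner_kerM mulr_suml; apply/eqP.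
apply: eq_bigr => j _; rewrite innerZl adjPl shaE innerZr' cjK; ring.
Qed.

(* The monomials span an invariant subspace [N] containing [1], and the
   component [q] of [k_w] orthogonal to [N] is the one of the image of [q] under
   the strict contraction [sum_j cj w_j S_j]. *)
Lemma monomial_total : total monomial.
Proof.
move=> f hf; apply: (ker_total (H := H)) => w.
apply: (orth_cspan hf).
have cN := cspan_closed monomial; have [_ N0 ND NZ] := cN.
have Nsh j x : cspan monomial x -> cspan monomial (sh H j x).
  apply: (cspan_min (bop_closed (sh H j) cN)) => s.
  by rewrite /=; exact: (cspan_in monomial (j :: s)).
have [p Np hp] := projection (ker H w) cN.
pose q := ker H w - p.
pose m := one H + \sum_j cj (zc w j) *: sh H j p.
have Nm : cspan monomial m.
  apply: (ND); first exact: (cspan_in monomial [::]).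
  by apply: (big_ind (cspan monomial)) => [//|//|j _]; apply/NZ/Nsh.
have e : ker H w - m = \sum_j cj (zc w j) *: sh H j q.
  rewrite {1}ker_fix /m opprD addrACA subrr add0r -sumrB; apply: eq_bigr => j _.
  by rewrite -scalerBr /q (linearB (sh H j)).
have hq : inner q q = \sum_j zc w j * inner (sha H j q) q.
  have : inner q (ker H w - m) = inner q q.
    by rewrite innerBr (hp _ Nm) subr0 {3}/q innerBr (hp _ Np) subr0.
  move=> <-; rewrite e inner_sumr; apply: eq_bigr => j _.
  by rewrite innerZr' cjK -adjP.
(* Each term of [hq] is split by [2 a b <= a^2 + b^2]; as [sum_j |S_j' q|^2 <= |q|^2], the factor is
   [(|w|^2 + 1) / 2 < 1]. *)
have hR : nr q ^+ 2 <= (\sum_j nr (zc w j) ^+ 2 + 1) / 2 * nr q ^+ 2.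
  have -> : nr q ^+ 2 = nr (inner q q) by rewrite innerxx nrR ger0_norm ?sqr_ge0.
  rewrite {1}hq; apply: le_trans (nr_sum _ _ _) _.
  apply: (@le_trans _ _ (\sum_j (nr (zc w j) ^+ 2 * nr q ^+ 2 + nr (sha H j q) ^+ 2) / 2)).
    apply: ler_sum => j _; rewrite nrM.
    have := cauchy_schwarz (sha H j q) q; have := nr_ge0 (zc w j).
    have := sqr_ge0 (nr (zc w j) * nr q - nr (sha H j q)).
    move: (nr (inner _ _)) (nr (sha _ _ _)) (nr q) (nr (zc w j)) => a b c d; nra.
  rewrite -mulr_suml big_split /= row_normH -mulr_suml innerxx nrR ger0_norm ?sqr_ge0 //.
  have := sqr_ge0 (nr (inner q (one H))); nra.
have q0 : q = 0.
  apply/eqP; rewrite -nr_eq0 -sqrf_eq0 eq_le sqr_ge0 andbT.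
  have := zc_lt1 w; have := sqr_ge0 (nr q); nra.
by move/eqP: q0; rewrite subr_eq0 => /eqP ->.
Qed.

Definition mon_nat (i : nat) : H := if unpickle i is Some s then monomial s else 0.

Lemma mon_nat_total : total mon_nat.
Proof.
by move=> f hf; apply: monomial_total => s; have := hf (pickle s); rewrite /mon_nat pickleK.
Qed.

Definition mon_span (i : nat) : set H := cspan (fun j : 'I_i => mon_nat j).

Lemma mon_orth_ex (i : nat) : exists q : H,
  mon_span i (mon_nat i - q) /\ forall x, mon_span i x -> inner q x = 0.
Proof.
have [p Np hp] := projection (mon_nat i) (cspan_closed (fun j : 'I_i => mon_nat j)).
by exists (mon_nat i - p); split=> //; rewrite opprB addrC subrK.
Qed.

(** Gram-Schmidt without normalization. Words that differ by the order of their letters give the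
    same monomial, so these vectors can vanish; [basis_ex] renumbers the others. *)
Definition mon_orth i : H := sval (cid (mon_orth_ex i)).

Lemma mon_orthP i : mon_span i (mon_nat i - mon_orth i) /\
  forall x, mon_span i x -> inner (mon_orth i) x = 0.
Proof. exact: (svalP (cid (mon_orth_ex i))). Qed.

Lemma mon_orth_in i j : (j < i)%N -> mon_span i (mon_orth j).
Proof.
move=> ji; have [_ _ ND NZ] := cspan_closed (fun j : 'I_i => mon_nat j).
have -> : mon_orth j = mon_nat j + (-1) *: (mon_nat j - mon_orth j) by vring.
apply: ND; first exact: (cspan_in (fun j : 'I_i => mon_nat j) (Ordinal ji)).
apply: NZ; apply: (cspan_min (cspan_closed _)) (mon_orthP j).1 => k.
exact: (cspan_in (fun j : 'I_i => mon_nat j) (Ordinal (ltn_trans (ltn_ord k) ji))).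
Qed.

Lemma mon_orth_orth i j : i != j -> inner (mon_orth i) (mon_orth j) = 0.
Proof.
rewrite neq_ltn => /orP[h|h].
  by rewrite inner_cj (mon_orthP j).2 ?cj0 //; exact: mon_orth_in.
by rewrite (mon_orthP i).2 //; exact: mon_orth_in.
Qed.

Lemma mon_orth_total : total mon_orth.
Proof.
move=> f hf; apply: mon_nat_total => i; elim/ltn_ind: i => i IH.
have -> : mon_nat i = mon_orth i + (mon_nat i - mon_orth i) by vring.
rewrite innerDr hf add0r; apply: (orth_cspan _ (mon_orthP i).1) => j.
exact: IH.
Qed.

Let j0 : 'I_n := Ordinal hn.

(** Provides infinitely many values of one coordinate; [m.+2] keeps them below [1]. *)
Lemma point_ex (m : nat) : exists w : X, zc w j0 = (m.+2%:R^-1)%:C.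
Proof.
pose v : 'rV[R[i]]_n := \row_j if j == j0 then (m.+2%:R^-1 : R)%:C else 0.
have hv : unit_ball v.
  rewrite /unit_ball /= (bigD1 j0) //= big1 => [|j jj0]; last first.
    by rewrite mxE (negbTE jj0) normr0 expr0n.
  rewrite mxE eqxx addr0 nrE nrR -rmorphXn [X in _ < X](_ : 1 = (1 : R)%:C) // ltcR.
  rewrite ger0_norm ?invr_ge0 // expr_lt1 ?invr_ge0 //.
  by rewrite invf_lt1 ?ltr0n // ltr1n.
by exists (SigSub (mem_set hv)); rewrite /zc /= mxE eqxx.
Qed.

Lemma iter_sh_eval (l : nat) (w : X) :
  rk_eval (iter l (sh H j0) (one H)) w = zc w j0 ^+ l.
Proof.
elim: l => [|l IH]; last by rewrite iterS sh_eval IH exprS.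
by rewrite rk_reproducing inner_cj inner_ker_one cj1.
Qed.

(* The powers of a coordinate are linearly independent, so that finitely many
   vectors cannot be total. *)
Lemma mon_orth_infinite : infinite_set [set i | mon_orth i <> 0].
Proof.
move=> fin.
have [d hd] : exists d, forall i, mon_orth i <> 0 -> (i < d)%N.
  have /finite_seqP[s hs] := fin.
  exists (\max_(i <- s) i).+1 => i hi.
  have : i \in s by have : [set` s] i by rewrite -hs.
  by move=> si; rewrite ltnS (big_rem i) //= leq_maxl.
pose f l := iter l (sh H j0) (one H).
pose A : 'M[R[i]]_(d.+1, d) := \matrix_(l, i) inner (f l) (mon_orth i).
(* With [d.+1] rows and [d] columns, [A] has a non-zero left kernel vector: a combination of the
   powers [f l] orthogonal to every [mon_orth i]. *)
have /rowV0Pn[v /sub_kermxP vA v0] : kermx A != 0.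
  rewrite kermx_eq0 /row_free; apply/eqP => rA.
  by have := rank_leq_col A; rewrite rA ltnn.
have g0 : \sum_(l < d.+1) v ord0 l *: f l = 0.
  apply: mon_orth_total => i.
  have [->|/eqP i0] := eqVneq (mon_orth i) 0; first by rewrite inner0r.
  have /matrixP/(_ ord0 (Ordinal (hd _ i0))) := vA; rewrite !mxE => <-.
  by rewrite inner_suml; apply: eq_bigr => l _; rewrite innerZl mxE.
pose p := \poly_(l < d.+1) (v ord0 (inord l)).
have : p = 0.
  (* The vanishing combination, evaluated at [d.+1] points of the ball, gives too many roots for a
     polynomial of degree at most [d]. *)
  pose rs : seq R[i] := mkseq (fun m => (m.+2%:R^-1 : R)%:C) d.+1.
  apply: (@roots_geq_poly_eq0 _ _ rs).
  - apply/allP => _ /mapP[m _ ->]; apply/rootP; rewrite horner_poly.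
    have [w <-] := point_ex m.
    transitivity (inner (\sum_(l < d.+1) v ord0 l *: f l) (ker H w)); last first.
      by rewrite g0 inner0l.
    rewrite inner_suml; apply: eq_bigr => l _.
    by rewrite innerZl -rk_reproducing iter_sh_eval inord_val.
  - rewrite map_inj_uniq ?iota_uniq // => a b /complexI /invr_inj /eqP.
    by rewrite eqr_nat eqSS eqSS => /eqP.
  - by rewrite size_mkseq size_poly.
move=> p0; case/eqP: v0; apply/rowP => l; rewrite mxE.
have := congr1 (fun p : {poly R[i]} => p`_l) p0.
by rewrite coef_poly ltn_ord inord_val coef0.
Qed.

Lemma basis_ex : exists e : nat -> H,
  (forall i j, inner (e i) (e j) = (i == j)%:R) /\ total e.
Proof.
have /card_esym/card_set_bijP[f [f1 f2 f3]] :=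
  eq_card_nat (countableP _) mon_orth_infinite.
pose g i := mon_orth (f i).
have g0 i : nr (g i) != 0 by rewrite nr_eq0; apply/eqP; apply: f1.
exists (fun i => (nr (g i))^-1%:C *: g i); split=> [i j|x hx].
  rewrite innerZl innerZr' cj_real; have [<-|ij] := eqVneq i j.
    rewrite innerxx -!rmorphM (_ : _ * _ = 1) //; field; exact: g0.
  by rewrite mon_orth_orth ?mulr0 //; apply: contra_neq ij => /f2; apply; rewrite inE.
apply: mon_orth_total => i.
have [->|/eqP i0] := eqVneq (mon_orth i) 0; first by rewrite inner0r.
have [k _ <-] := f3 _ i0.
have /eqP := hx k; rewrite innerZr' cj_real mulf_eq0 => /orP[|/eqP //].
by rewrite -[0]/(0%:C) (inj_eq (@complexI R)) invr_eq0 (negbTE (g0 k)).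
Qed.

End Basis.

(** * Square roots and the tensor product with an infinite-dimensional space *)

Section Sqrt.
Variables (R : realType).

Lemma sesq_ext (V U : hilbertType R) (A B : bop V U) (I : Type) (s : I -> V) (c : R[i]) :
  total s -> (forall i j, inner (A (s i)) (B (s j)) = c * inner (s i) (s j)) ->
  forall x y, inner (A x) (B y) = c * inner x y.
Proof.
move=> ts h x y; rewrite -adjPl -bcompE.
rewrite (bop_ext ts (A := bcomp (adj B) A) (B := bscale c (bop1 V))).
  by rewrite bscaleE /= innerZl.
move=> i; rewrite bcompE bscaleE /=; apply: (total_ext ts) => j.
by rewrite adjPl h innerZl.
Qed.

Variables (G : hilbertType R) (V : nat -> bop G G).
Hypothesis VV : forall i j x y, inner (V i x) (V j y) = (i == j)%:R * inner x y.

(** The operator inequality [0 <= A <= 1]. *)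
Definition unit_pos (A : bop G G) : Prop :=
  (forall x y, inner (A x) y = inner x (A y)) /\
  forall x, 0 <= complex.Re (inner (A x) x) <= nr x ^+ 2.

Lemma unit_pos_step A : unit_pos A -> unit_pos (bsub A (bcomp A A)).
Proof.
move=> [Asa Ap]; split=> [x y|x].
  by rewrite !bsubE !bcompE innerBl innerBr !Asa.
rewrite bsubE bcompE innerBl (Asa (A x) x) raddfB /=.
(* [A - A^2 = A (1 - A) A + (1 - A) A (1 - A)], a sum of two positive operators. *)
have -> : complex.Re (inner (A x) x) - complex.Re (inner (A x) (A x)) =
  nr (A x) ^+ 2 - complex.Re (inner (A (A x)) (A x)) +
  complex.Re (inner (A (x - A x)) (x - A x)).
  rewrite linearB !innerBl !innerBr !raddfB /= !(Asa (A x) x) -nr_sqE; ring.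
have /andP[p1 p2] := Ap (A x); have /andP[p3 p4] := Ap (x - A x).
apply/andP; split; first by lra.
have -> : nr (A x) ^+ 2 - complex.Re (inner (A (A x)) (A x)) +
  complex.Re (inner (A (x - A x)) (x - A x)) = complex.Re (inner (A x) x) - nr (A x) ^+ 2.
  rewrite linearB !innerBl !innerBr !raddfB /= !(Asa (A x) x) -nr_sqE; ring.
have /andP[_ p5] := Ap x; have := sqr_ge0 (nr (A x)); lra.
Qed.

Lemma selfadj_eq0 (B : bop G G) : (forall x y, inner (B x) y = inner x (B y)) ->
  (forall x, complex.Re (inner (B x) x) = 0) -> forall x, B x = 0.
Proof.
move=> Bsa B0 x; have := B0 (x + B x).
rewrite linearD !innerDl !innerDr !raddfD /= !B0 (Bsa (B x) x) -nr_sqE => h.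
by apply/eqP; rewrite -nr_eq0 -sqrf_eq0; apply/eqP; lra.
Qed.

(* With [A_0 = A] and [A_(k+1) = A_k - A_k^2], the form [<A x, x>] is the sum of
   the [|A_k x|^2]; the isometries [V_k] assemble the [A_k] into one operator. *)
Theorem sqrt_ex (A : bop G G) : unit_pos A ->
  exists L : bop G G, forall x y, inner (L x) (L y) = inner (A x) y.
Proof.
move=> Apos.
pose B := fix B k := if k is k'.+1 then bsub (B k') (bcomp (B k') (B k')) else A.
have Bpos k : unit_pos (B k) by elim: k => //= k; exact: unit_pos_step.
pose a k x := complex.Re (inner (B k x) x).
have a_ge0 k x : 0 <= a k x by have [_ /(_ x)/andP[]] := Bpos k.
have aS k x : a k.+1 x = a k x - nr (B k x) ^+ 2.
  by rewrite /a /= bsubE bcompE innerBl raddfB /= ((Bpos k).1 (B k x) x) -nr_sqE.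
have a_dec x m n : (m <= n)%N -> a n x <= a m x.
  move=> /subnKC <-; elim: (n - m)%N => [|j IH]; first by rewrite addn0.
  by rewrite addnS aS; apply: le_trans IH; rewrite lerBlDr lerDl sqr_ge0.
(* [a k x] drops by [|B_k x|^2] at each step and stays non-negative, so some [|B_N x|] is at most
   [d]; then [a N x <= |B_N x| |x| <= e]. *)
have a_lim x (e : R) : 0 < e -> exists N, forall k, (N <= k)%N -> a k x <= e.
  move=> e0; have x1 : 0 < nr x + 1 by rewrite ltr_wpDl ?nr_ge0.
  pose d := e / (nr x + 1); have d0 : 0 < d by rewrite divr_gt0.
  have [[N hN]|h] := pselect (exists N, nr (B N x) <= d).
    exists N => k Nk; apply: le_trans (a_dec _ _ _ Nk) _; rewrite /a.
    apply: le_trans (nr_Re _) _; apply: le_trans (cauchy_schwarz _ _) _.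
    move: hN; rewrite /d ler_pdivlMr // => hN.
    have := nr_ge0 x; have := nr_ge0 (B N x); nra.
  have h' k : d ^+ 2 <= nr (B k x) ^+ 2.
    rewrite ler_pXn2r ?nnegrE ?nr_ge0 ?(ltW d0) // leNgt; apply/negP => /ltW hk.
    by apply: h; exists k.
  have hk k : a k x <= a 0%N x - k%:R * d ^+ 2.
    elim: k => [|k IH]; first by rewrite mul0r subr0.
    by rewrite aS -natr1 mulrDl mul1r; have := h' k; lra.
  have d2 : 0 < d ^+ 2 by rewrite exprn_gt0.
  have := hk (Num.trunc (a 0%N x / d ^+ 2)).+1.
  have := truncnS_gt (a 0%N x / d ^+ 2); rewrite ltr_pdivrMr //.
  have := a_ge0 (Num.trunc (a 0%N x / d ^+ 2)).+1 x.
  move: (_.+1%:R * d ^+ 2) => z; lra.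
(* Partial sums of [sum_k V_k B_k]. The ranges of the [V_k] are orthogonal, so [|S_N x|^2]
   telescopes to [a 0 x - a N x]. *)
pose S := fix S k := if k is k'.+1 then badd (S k') (bcomp (V k') (B k')) else bop0 G G.
have SV k m x y : (k <= m)%N -> inner (S k x) (V m y) = 0.
  elim: k => [|k IH] km /=; first by rewrite inner0l.
  by rewrite baddE bcompE innerDl IH ?(ltnW km) // VV (ltn_eqF km) mul0r addr0.
have Sd N k x : nr (S (N + k)%N x - S N x) ^+ 2 = a N x - a (N + k)%N x.
  elim: k => [|k IH]; first by rewrite addn0 !subrr nr0 expr0n.
  rewrite addnS /= baddE bcompE addrAC pythagoras; last first.
    by rewrite innerBl !SV ?leq_addr // subr0.
  rewrite IH -/(a (N + k).+1 x) aS.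
  have -> : nr (V (N + k)%N (B (N + k)%N x)) ^+ 2 = nr (B (N + k)%N x) ^+ 2.
    by rewrite !nr_sqE VV eqxx mul1r.
  ring.
have Sn N x : nr (S N x) ^+ 2 = a 0%N x - a N x.
  by rewrite -Sd /= subr0.
have [||L hL] := @strong_limit _ _ _ S 1.
- move=> N x; rewrite mul1r; apply: ler_sq; first exact: nr_ge0.
  rewrite Sn; have [_ /(_ x)/andP[_ h]] := Apos.
  by have := a_ge0 N x; rewrite /a /= in h *; lra.
- move=> x e e0; have [N hN] := a_lim x (e ^+ 2) (exprn_gt0 2 e0).
  have main m k : (N <= m)%N -> nr (S (m + k)%N x - S m x) <= e.
    move=> Nm; apply: ler_sq; first exact: ltW.
    by rewrite Sd; have := hN _ Nm; have := a_ge0 (m + k)%N x; lra.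
  exists N => m k Nm Nk; have [mk|/ltnW km] := leqP m k.
    by rewrite nrB -(subnKC mk); exact: main.
  by rewrite -(subnKC km); exact: main.
have Ln x : nr (L x) ^+ 2 = a 0%N x.
  apply/le_anti/andP; split.
    suff h (e : R) : 0 < e -> nr (L x) ^+ 2 <= a 0%N x + e by apply/ler_addgt0Pr.
    move=> e0; pose b := 2 * nr x + 1; have b0 : 0 < b by have := nr_ge0 x; rewrite /b; lra.
    pose d : R := Num.min 1 (e / b).
    have d0 : 0 < d by rewrite lt_min ltr01 divr_gt0.
    have d1 : d <= 1 by rewrite ge_min lexx.
    have db : d * b <= e by rewrite -ler_pdivlMr // ge_min lexx orbT.
    have [N /(_ N (leqnn N)) hN] := hL x _ d0.
    have tri : nr (L x) <= nr (L x - S N x) + nr (S N x).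
      by rewrite -[X in nr X <= _](subrK (S N x) (L x)); exact: nrD.
    have Sx : nr (S N x) <= nr x.
      apply: ler_sq; first exact: nr_ge0.
      rewrite Sn; have [_ /(_ x)/andP[_ h]] := Apos.
      by have := a_ge0 N x; rewrite /a /= in h *; lra.
    have : nr (S N x) ^+ 2 <= a 0%N x by rewrite Sn; have := a_ge0 N x; lra.
    have := nr_ge0 (L x); have := nr_ge0 (S N x); have := nr_ge0 (L x - S N x).
    rewrite /b in db; move: tri hN Sx db d1 d0.
    move: (nr (L x)) (nr (S N x)) (nr (L x - S N x)) (nr x) (a 0%N x) d => l s z t a0 d tri hN Sx db d1 d0 z0 s0 l0 h.
    have ld : l <= s + d by lra.
    have : l ^+ 2 <= (s + d) ^+ 2 by rewrite ler_pXn2r ?nnegrE //; lra.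
    nra.
  suff h (e : R) : 0 < e -> a 0%N x <= nr (L x) ^+ 2 + e by apply/ler_addgt0Pr.
  move=> e0; pose b := 2 * nr (L x) + 2; have b0 : 0 < b by have := nr_ge0 (L x); rewrite /b; lra.
  pose d : R := Num.min 1 (e / 2 / b).
  have d0 : 0 < d by rewrite lt_min ltr01 !divr_gt0.
  have d1 : d <= 1 by rewrite ge_min lexx.
  have db : d * b <= e / 2 by rewrite -ler_pdivlMr // ge_min lexx orbT.
  have [N1 h1] := hL x _ d0; have [N2 h2] := a_lim x (e / 2) (divr_gt0 e0 (ltr0n _ 2)).
  pose N := maxn N1 N2; have := h1 N (leq_maxl _ _); have := h2 N (leq_maxr _ _).
  have := Sn N x; have := nr_ge0 (L x); have := nr_ge0 (S N x).
  have tri : nr (S N x) <= nr (L x - S N x) + nr (L x).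
    by rewrite nrB -[X in nr X <= _](subrK (L x) (S N x)); exact: nrD.
  rewrite /b in db; move: tri db d1 d0.
  move: (nr (L x)) (nr (S N x)) (nr (L x - S N x)) d (a 0%N x) (a N x) {h1} => l s z d a0 aN tri db d1 d0 s0 l0 hs haN zd.
  have sd : s <= l + d by lra.
  have : s ^+ 2 <= (l + d) ^+ 2 by rewrite ler_pXn2r ?nnegrE //; lra.
  nra.
(* [L' L - A] is self-adjoint with vanishing quadratic form, hence zero. *)
exists L => x y.
have := @selfadj_eq0 (bsub (bcomp (adj L) L) A).
move=> h; rewrite -adjPl; apply/eqP; rewrite -subr_eq0 -innerBl -bcompE -bsubE h ?inner0l //.
  by move=> u v; rewrite !bsubE !bcompE innerBl innerBr adjPl -adjP Apos.1.
by move=> u; rewrite bsubE bcompE innerBl adjPl raddfB /= -nr_sqE Ln subrr.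
Qed.

End Sqrt.

Section SelfTensor.
Variables (R : realType) (H F : hilbertType R) (T : tensor2 H F).
Variables (e : nat -> H).
Hypotheses (ee : forall i j, inner (e i) (e j) = (i == j)%:R) (et : total e).

(* [H] is infinite dimensional and separable, so that [H (x) H] is isomorphic to
   [H]; hence the space of [H (x) T] can be taken to be [T] itself. *)
Lemma self_op_ex : exists op : H -> T -> T,
  (forall x x' y y', inner (op x y) (op x' y') = inner x x' * inner y y') /\
  dense (lin_span [set v | exists x y, v = op x y]).
Proof.
have /card_set_bijP[b [_ binj bsurj]] := card_nat2.
have bE i j i' j' : (b (i, j) == b (i', j')) = (i == i') && (j == j').
  apply/eqP/andP => [/binj|[/eqP -> /eqP ->] //].
  by move=> /(_ (mem_set I) (mem_set I))[-> ->].
(* [V j] sends [e i] to the basis vector numbered by [(i, j)], and [W x] will send [e j] to [V j x].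
   Thus [W x y] is the image of [x (x) y] under a unitary from [H (x) H] to [H], and [op x] is [W x]
   on the first factor of [T]. *)
have Vex j : exists V : bop H H, forall i, V (e i) = e (b (i, j)).
  apply: (extension_iso et ler01) => i i'.
  by rewrite !ee bE eqxx andbT mul1r.
have [V hV] := choice Vex.
have VV j k x y : inner (V j x) (V k y) = (j == k)%:R * inner x y.
  apply: (sesq_ext et) => i i'; rewrite !hV !ee bE.
  by case: (i == i'); case: (j == k); rewrite ?mulr0 ?mul0r ?mulr1.
have Wex x : exists W : bop H H, forall j, W (e j) = V j x.
  apply: (extension_iso et (sqr_ge0 (nr x))) => i i'.
  by rewrite VV ee -innerxx mulrC.
have [W hW] := choice Wex.
have WW x x' y y' : inner (W x y) (W x' y') = inner x x' * inner y y'.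
  by apply: (sesq_ext et) => i i'; rewrite !hW VV ee mulrC.
pose op x (t : T) := ampl T T (W x) t; exists op; split.
  move=> x x' y y'; rewrite /op; move: y y'.
  apply: (sesq_ext (@elem_total _ _ _ T)) => -[u v] [u' v'].
  by rewrite /elem !amplE !tens2_inner WW mulrA.
apply: (@total_dense _ _ _ (fun p : H * T => op p.1 p.2)) => [|[x y]]; last by exists x, y.
move=> z hz; apply: (@tens2_total _ _ _ T _ _ e id et) => [x /(_ x)/inner_eq0 //|[k y]] /=.
have [|[i j] _ <-] := bsurj k; first by [].
by have := hz (e i, tens2 T (e j) y); rewrite /op /= amplE hW hV.
Qed.

Definition self_tensor : tensor2 H T :=
  @Tensor2 R H T T (sval (cid self_op_ex)) (svalP (cid self_op_ex)).1
    (svalP (cid self_op_ex)).2.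

End SelfTensor.

(** * Spans of elementary operators *)

Section Multipliers.
Variables (R : realType) (n : nat) (H : drury_arveson R n).

Lemma mult_of (phi : 'rV[R[i]]_n -> R[i]) (A : bop H H) :
  holomorphic_on_ball phi -> is_mulop phi A -> multiplier_algebra H A.
Proof. by move=> hol mA; exists phi => //; split=> // f; exists (A f) => z; apply: mA. Qed.

Lemma mult_id : multiplier_algebra H (bop1 H).
Proof.
apply: (@mult_of (fun=> 1)); last by move=> f z /=; rewrite mul1r.
by move=> z _; exact: differentiable_cst.
Qed.

Lemma mult_sh j : multiplier_algebra H (sh H j).
Proof.
apply: mult_of (@sh_mulop _ _ H j) => z _; exact: differentiable_coord.
Qed.

Lemma mult_comp (A B C : bop H H) : multiplier_algebra H A -> multiplier_algebra H B ->
  (forall x, C x = A (B x)) -> multiplier_algebra H C.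
Proof.
move=> [phi [hphi _] mphi] [psi [hpsi _] mpsi] hC.
apply: (@mult_of (fun z => phi z * psi z)) => [z bz|f z].
  by apply: (@differentiableM _ _ phi psi); [exact: hphi|exact: hpsi].
by rewrite hC mphi mpsi mulrA.
Qed.

Section Span.
Variables (E F : hilbertType R) (TE : tensor2 H E) (TF : tensor2 H F).

Definition mult_span : set (bop TE TF) :=
  op_span (elementary_ops TE TF (multiplier_algebra H)).

Lemma mult_span_ext (A B : bop TE TF) : mult_span A -> (forall x, A x = B x) -> mult_span B.
Proof. by move=> [N [a [C [hC hA]]]] AB; exists N, a, C; split=> // x; rewrite -AB. Qed.

Lemma mult_span0 : mult_span (bop0 TE TF).
Proof. by exists 0%N, (fun=> 0), (fun=> bop0 TE TF); split=> [[]//|x]; rewrite big_ord0. Qed.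

Lemma mult_spanD A B : mult_span A -> mult_span B -> mult_span (badd A B).
Proof.
move=> [N [a [C [hC hA]]]] [P [b [D [hD hB]]]].
exists (N + P)%N.
exists (fun l => match fintype.split l with inl i => a i | inr i => b i end).
exists (fun l => match fintype.split l with inl i => C i | inr i => D i end).
split; first by move=> l; case: (fintype.split l).
move=> x; rewrite baddE hA hB big_split_ord /=; congr (_ + _); apply: eq_bigr => l _.
  by rewrite -[lshift P l]/(unsplit (inl l)) unsplitK.
by rewrite -[rshift N l]/(unsplit (inr l)) unsplitK.
Qed.

Lemma mult_spanZ c A : mult_span A -> mult_span (bscale c A).
Proof.
move=> [N [a [C [hC hA]]]]; exists N, (fun l => c * a l), C; split=> // x.
by rewrite bscaleE hA scaler_sumr; apply: eq_bigr => l _; rewrite scalerA.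
Qed.

Lemma mult_span_sub C : elementary_ops TE TF (multiplier_algebra H) C -> mult_span C.
Proof.
by move=> hC; exists 1%N, (fun=> 1), (fun=> C); split=> // x; rewrite big_ord1 scale1r.
Qed.

(** The first premise is there because operators are compared through their values only. *)
Lemma mult_span_ind (P : bop TE TF -> Prop) :
  (forall A B : bop TE TF, P A -> (forall x, A x = B x) -> P B) -> P (bop0 TE TF) ->
  (forall c A B, elementary_ops TE TF (multiplier_algebra H) A -> P B -> P (badd (bscale c A) B)) ->
  forall A, mult_span A -> P A.
Proof.
move=> Pext P0 PD A [N [a [C [hC hA]]]].
elim: N a C hC A hA => [|N IH] a C hC A hA.
  by apply: Pext P0 _ => x; rewrite hA big_ord0.
have := IH (fun l => a (lift ord0 l)) (fun l => C (lift ord0 l)) (fun l => hC _)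
   (bsum (fun l : 'I_N => bscale (a (lift ord0 l)) (C (lift ord0 l)))).
move=> h; apply: Pext (PD (a ord0) _ _ (hC ord0) (h _)) _ => x; last first.
  rewrite baddE bscaleE hA big_ord_recl bsumE; congr (_ + _).
  by apply: eq_bigr => l _; rewrite bscaleE.
by rewrite bsumE; apply: eq_bigr => l _; rewrite bscaleE.
Qed.

End Span.

Lemma mult_span_comp (E F G : hilbertType R) (TE : tensor2 H E) (TF : tensor2 H F)
    (TG : tensor2 H G) (A : bop TF TG) (B : bop TE TF) :
  mult_span A -> mult_span B -> mult_span (bcomp A B).
Proof.
move=> sA sB; move: A sA; apply: mult_span_ind => [A A' h AA'||c A A' [M [b [hM hb]]] IH].
- by apply: mult_span_ext h _ => x; rewrite !bcompE AA'.
- by apply: mult_span_ext (mult_span0 TE TG) _ => x; rewrite bcompE.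
have : mult_span (bcomp A B); last first.
  move=> h; apply: mult_span_ext (mult_spanD (mult_spanZ c h) IH) _ => x.
  by rewrite !(baddE, bscaleE, bcompE).
move: B sB {IH}; apply: mult_span_ind => [B B' h BB'||d B B' [M' [b' [hM' hb']]] IH].
- by apply: mult_span_ext h _ => x; rewrite !bcompE BB'.
- by apply: mult_span_ext (mult_span0 TE TG) _ => x; rewrite bcompE /= linear0.
have h : mult_span (bcomp A B).
  apply: mult_span_sub; exists (bcomp M M'), (bcomp b b'); split.
    by apply: mult_comp hM hM' _ => x; rewrite bcompE.
  by move=> x y; rewrite !bcompE hb' hb.
apply: mult_span_ext (mult_spanD (mult_spanZ d h) IH) _ => x.
by rewrite !(baddE, bscaleE, bcompE) linearD linearZ.
Qed.

(** Realizations are built on the adjoint side, where the action on kernel vectors is explicit;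
    membership is followed through sums and compositions on that side. *)
Definition adj_span (E F : hilbertType R) (TE : tensor2 H E) (TF : tensor2 H F)
  (D : bop TE TF) : Prop := mult_span (adj D).

Section AdjSpan.
Variables (E F G : hilbertType R) (TE : tensor2 H E) (TF : tensor2 H F) (TG : tensor2 H G).

Lemma adj_span0 : adj_span (bop0 TE TF).
Proof.
apply: mult_span_ext (mult_span0 TF TE) _ => x; apply: inner_ext => z.
by rewrite adjPl /= inner0l inner0r.
Qed.

Lemma adj_spanD (A B : bop TE TF) : adj_span A -> adj_span B -> adj_span (badd A B).
Proof.
move=> hA hB; apply: mult_span_ext (mult_spanD hA hB) _ => x; apply: inner_ext => z.
by rewrite baddE innerDl !adjPl baddE innerDr.
Qed.

Lemma adj_spanZ c (A : bop TE TF) : adj_span A -> adj_span (bscale c A).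
Proof.
move=> hA; apply: mult_span_ext (mult_spanZ (cj c) hA) _ => x; apply: inner_ext => z.
by rewrite bscaleE innerZl !adjPl bscaleE innerZr'.
Qed.

Lemma adj_span_sum m (A : 'I_m -> bop TE TF) :
  (forall j, adj_span (A j)) -> adj_span (bsum A).
Proof.
move=> hA; rewrite /bsum; elim/big_ind: _ => //; first exact: adj_span0.
exact: adj_spanD.
Qed.

Lemma adj_span_comp (A : bop TF TG) (B : bop TE TF) :
  adj_span A -> adj_span B -> adj_span (bcomp A B).
Proof.
move=> hA hB; apply: mult_span_ext (mult_span_comp hB hA) _ => x; apply: inner_ext => z.
by rewrite bcompE !adjPl bcompE.
Qed.

Lemma adj_span_ampr (B : bop E F) : adj_span (ampr TE TF B).
Proof.
apply: mult_span_sub; exists (bop1 H), (adj B); split; first exact: mult_id.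
by move=> x y; rewrite ampr_adj.
Qed.

Lemma adj_span_SA j : adj_span (SA TE j).
Proof.
apply: mult_span_sub; exists (sh H j), (bop1 E); split; first exact: mult_sh.
by move=> x y; rewrite ampl_adj.
Qed.

End AdjSpan.

End Multipliers.

(** * Adjoint bounds and limits of operator sequences *)

Section Limits.
Variable R : realType.

Lemma adj_bound (V W : hilbertType R) (A : bop V W) (C : R) :
  0 <= C -> (forall x, nr (A x) <= C * nr x) -> forall y, nr (adj A y) <= C * nr y.
Proof.
move=> C0 hA y; have [->|y0] := eqVneq (adj A y) 0; first by rewrite nr0 mulr_ge0 ?nr_ge0.
have fy : 0 < nr (adj A y) by rewrite lt_neqAle eq_sym nr_eq0 y0 nr_ge0.
rewrite -(ler_pM2r fy) -expr2 nr_sqE adjPl.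
apply: le_trans (nr_Re _) _; apply: le_trans (cauchy_schwarz _ _) _.
by rewrite mulrC mulrAC; apply: ler_wpM2r; rewrite ?nr_ge0.
Qed.

(** Together with [total_subspace], it reduces strong convergence of a bounded sequence to kernel
    vectors. *)
Lemma pointwise_zero (V W : hilbertType R) (A : nat -> bop V W) (C : R) :
  0 <= C -> (forall m x, nr (A m x) <= C * nr x) ->
  is_closed_subspace [set x | forall e : R, 0 < e ->
    exists N, forall m, (N <= m)%N -> nr (A m x) <= e].
Proof.
move=> C0 hA; split=> [||x y /= hx hy e e0|a x /= hx e e0].
- apply: closedP => p hp e e0; have C1 : 0 < 2 * (C + 1) by lra.
  have [x /= hx px] := hp _ (divr_gt0 e0 C1).
  have [N hN] := hx _ (divr_gt0 e0 (ltr0n _ 2)); exists N => m /hN h.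
  rewrite -(subrK x p) linearD; apply: le_trans (nrD _ _) _.
  have := hA m (p - x); move: px; rewrite ler_pdivlMr //.
  have := nr_ge0 (p - x); nra.
- by move=> e e0; exists 0%N => m _; rewrite linear0 nr0 ltW.
- have e2 := divr_gt0 e0 (ltr0n R 2).
  have [N1 h1] := hx _ e2; have [N2 h2] := hy _ e2; exists (maxn N1 N2) => m.
  rewrite geq_max => /andP[/h1 a1 /h2 a2]; rewrite linearD.
  apply: le_trans (nrD _ _) _; lra.
- have a1 : 0 < nr a + 1 by rewrite ltr_wpDl ?nr_ge0.
  have [N h] := hx _ (divr_gt0 e0 a1); exists N => m /h.
  rewrite linearZ nrZ ler_pdivlMr //; have := nr_ge0 a; have := nr_ge0 (A m x); nra.
Qed.

Lemma neumann_bop (V : hilbertType R) (Z : bop V V) (q : R) :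
  0 <= q < 1 -> (forall x, nr (Z x) <= q * nr x) ->
  exists N : bop V V, forall y, N y = y + Z (N y).
Proof.
move=> q01 hZ; have [f hf] := choice (neumann q01 hZ).
have /andP[q0 q1] := q01; have p0 : 0 < 1 - q by lra.
have uniq (d : V) : d = Z d -> d = 0.
  move=> dd; apply/eqP; rewrite -nr_eq0 eq_le nr_ge0 andbT.
  have := hZ d; rewrite -dd; have := nr_ge0 d; nra.
have [||N hN] := @mkbop _ _ _ f (1 - q)^-1.
- move=> a x y; apply/eqP; rewrite -subr_eq0; apply/eqP/uniq.
  rewrite (linearB Z) (linearP Z) {1}hf {1}(hf x) {1}(hf y); vring.
- move=> x; rewrite mulrC ler_pdivlMr //.
  have : nr (f x) <= nr x + nr (Z (f x)) by rewrite {1}hf; exact: nrD.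
  have := hZ (f x); lra.
by exists N => y; rewrite !hN.
Qed.

End Limits.

(** * Realization of contractive multipliers *)

Section Realization.
Variables (R : realType) (n : nat) (H : drury_arveson R n).
Variables (F G : hilbertType R) (T : tensor2 H F) (TG : tensor2 H G).
Variables (V : nat -> bop G G) (iota : bop F G) (C : bop G G).
Hypothesis VV : forall i j x y, inner (V i x) (V j y) = (i == j)%:R * inner x y.
Hypothesis iotaI : forall x y, inner (iota x) (iota y) = inner x y.
Hypothesis iotaV : forall j x y, inner (iota x) (V j.+1 y) = 0.
Hypothesis Cle : forall x, nr (C x) <= nr x.
Local Notation X := (unit_ball (R := R) (n := n)).

Lemma ampr_comp (E1 E2 E3 : hilbertType R) (T1 : tensor2 H E1) (T2 : tensor2 H E2)
    (T3 : tensor2 H E3) (A : bop E2 E3) (B : bop E1 E2) x :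
  ampr T1 T3 (bcomp A B) x = ampr T2 T3 A (ampr T1 T2 B x).
Proof.
rewrite -bcompE; apply: (bop_ext (@elem_total _ _ _ T1)) => -[u v].
by rewrite /elem bcompE !amprE bcompE.
Qed.

(* The isometries [iota], [V_1], [V_2], ... have orthogonal ranges: they identify
   [F (+) G^n] with a subspace of [G], and likewise [V_0], [V_1] for
   [G (+) G], so that [C] acts as a contraction [F (+) G^n -> G (+) G]. *)
Definition row_in (u : F) (g : 'I_n -> G) : G := iota u + \sum_(j < n) V j.+1 (g j).

(** The blocks of [C]: [a0] and [c0] start from the input, [b0 j] and [d0 j] from the [j]-th copy of
    the state; [a0] and [b0 j] end in the output, read by [V 0], and [c0] and [d0 j] in the new
    state, read by [V 1]. *)
Let a0 := bcomp (adj (V 0)) (bcomp C iota).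
Let c0 := bcomp (adj (V 1)) (bcomp C iota).
Let b0 (j : 'I_n) := bcomp (adj (V 0)) (bcomp C (V j.+1)).
Let d0 (j : 'I_n) := bcomp (adj (V 1)) (bcomp C (V j.+1)).

Let aT := ampr T TG a0.
Let cT := ampr T TG c0.
Let BT := bsum (fun j => bcomp (ampr TG TG (b0 j)) (SA TG j)).
Let ZT := bsum (fun j => bcomp (ampr TG TG (d0 j)) (SA TG j)).

Lemma ord_neqS (i j : 'I_n) : i != j -> (j.+1 == i.+1) = false.
Proof. by rewrite eq_sym eqSS => /negbTE. Qed.

Lemma nr_adjV k y : nr (adj (V k) y) <= nr y.
Proof.
rewrite -[nr y]mul1r; apply: adj_bound => [|x]; first exact: ler01.
by rewrite mul1r; apply: ler_sq; rewrite ?nr_ge0 // !nr_sqE VV eqxx mul1r.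
Qed.

Lemma bessel (K : hilbertType R) (A B : bop K K) :
  (forall x y, inner (A x) (A y) = inner x y) -> (forall x y, inner (B x) (B y) = inner x y) ->
  (forall x y, inner (A x) (B y) = 0) ->
  forall y, nr (adj A y) ^+ 2 + nr (adj B y) ^+ 2 <= nr y ^+ 2.
Proof.
move=> AA BB AB y.
have : 0 <= nr (y - (A (adj A y) + B (adj B y))) ^+ 2 by rewrite sqr_ge0.
rewrite nr_sqB (nr_sqD (A _)) AB !nr_sqE AA BB innerDr raddfD /=.
rewrite -(adjPl A y) -(adjPl B y).
move: (complex.Re (inner y y)) (complex.Re (inner (adj A y) _)) (complex.Re (inner (adj B y) _)).
move=> a b c; lra.
Qed.

Let VT k := ampr TG TG (V k).
Let iT := ampr T TG iota.

Lemma VT_orth i j x y : inner (VT i x) (VT j y) = (i == j)%:R * inner x y.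
Proof.
apply: (sesq_ext (@elem_total _ _ _ TG)) => -[u v] [u' v'].
by rewrite /elem /VT !amprE !tens2_inner VV; ring.
Qed.

Lemma nr_row (xi : T) (eta : 'I_n -> TG) :
  nr (iT xi + \sum_(j < n) VT j.+1 (eta j)) ^+ 2 = nr xi ^+ 2 + \sum_j nr (eta j) ^+ 2.
Proof.
have iTI x y : inner (iT x) (iT y) = inner x y.
  rewrite -[RHS]mul1r; apply: (sesq_ext (@elem_total _ _ _ T)) => -[u v] [u' v'].
  by rewrite /elem /iT !amprE !tens2_inner iotaI mul1r.
have iTV j x y : inner (iT x) (VT j.+1 y) = 0.
  rewrite -adjPl -bcompE; rewrite (bop_ext (@elem_total _ _ _ T) (B := bop0 T TG)) ?inner0l //.
  move=> [u v]; apply: (total_ext (@elem_total _ _ _ TG)) => -[u' v'].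
  by rewrite bcompE adjPl /elem /iT /VT !amprE tens2_inner iotaV mulr0 inner0l.
rewrite pythagoras; last by rewrite inner_sumr big1.
congr (_ + _); first by rewrite !nr_sqE iTI.
apply: (@complexI R); rewrite rmorph_sum /= -innerxx inner_suml; apply: eq_bigr => j _.
rewrite inner_sumr (bigD1 j) //= big1 ?addr0 => [|i ij].
  by rewrite VT_orth eqxx mul1r innerxx.
by rewrite VT_orth ord_neqS // mul0r.
Qed.

(** The two vectors on the left are the [VT 0] and [VT 1] components of the image of [zeta] under
    [I (x) C], so Bessel's inequality and [Cle] bound them by [|zeta|^2]; there the adjoint shifts
    contribute at most [r^2 |eta|^2]. *)
Lemma colligation (r : R) (xi : T) (eta : TG) :
  nr (aT xi + r%:C *: BT eta) ^+ 2 + nr (cT xi + r%:C *: ZT eta) ^+ 2 <=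
  nr xi ^+ 2 + r ^+ 2 * nr eta ^+ 2.
Proof.
pose zeta := iT xi + \sum_(j < n) VT j.+1 (r%:C *: SA TG j eta).
pose CT := ampr TG TG C.
have h k : ampr T TG (bcomp (adj (V k)) (bcomp C iota)) xi +
    r%:C *: bsum (fun j : 'I_n => bcomp (ampr TG TG (bcomp (adj (V k)) (bcomp C (V j.+1)))) (SA TG j)) eta
    = adj (VT k) (CT zeta).
  have adjV x : adj (VT k) x = ampr TG TG (adj (V k)) x.
    apply: (bop_ext (@elem_total _ _ _ TG)) => -[u v].
    by rewrite /elem ampr_adj amprE.
  rewrite /zeta linearD linear_sum adjV linearD linear_sum bsumE scaler_sumr.
  congr (_ + _); first by rewrite (@ampr_comp _ _ _ T TG TG) (@ampr_comp _ _ _ T TG TG).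
  apply: eq_bigr => j _; rewrite bcompE (@ampr_comp _ _ _ TG TG TG) (@ampr_comp _ _ _ TG TG TG).
  by rewrite !linearZ.
rewrite /aT /cT /BT /ZT /a0 /c0 /b0 /d0 !h.
apply: le_trans (bessel _ _ _ _) _ => [x y|x y|x y|].
- by rewrite VT_orth mul1r.
- by rewrite VT_orth mul1r.
- by rewrite VT_orth mul0r.
apply: (@le_trans _ _ (nr zeta ^+ 2)).
  rewrite ler_pXn2r ?nnegrE ?nr_ge0 // -[nr zeta]mul1r.
  by apply: ampr_bound => // x; rewrite mul1r.
rewrite nr_row lerD2l.
under eq_bigr do rewrite nrZ nrR exprMn.
rewrite -mulr_sumr row_norm real_normK ?num_real // ler_wpM2l ?sqr_ge0 //.
by rewrite lerBlDr lerDl sqr_ge0.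
Qed.

Lemma nr_ZT eta : nr (ZT eta) <= nr eta.
Proof.
apply: ler_sq; first exact: nr_ge0.
have := colligation 1 0 eta; rewrite !linear0 !add0r !scale1r nr0 expr0n add0r expr1n mul1r.
have := sqr_ge0 (nr (BT eta)); lra.
Qed.

Lemma nr_BT eta : nr (BT eta) <= nr eta.
Proof.
apply: ler_sq; first exact: nr_ge0.
have := colligation 1 0 eta; rewrite !linear0 !add0r !scale1r nr0 expr0n add0r expr1n mul1r.
have := sqr_ge0 (nr (ZT eta)); lra.
Qed.

Let Zw (w : X) := bsum (fun j => bscale (cj (zc w j)) (d0 j)).
Let Bw (w : X) := bsum (fun j => bscale (cj (zc w j)) (b0 j)).

Let q (w : X) : R := Num.sqrt (\sum_j nr (zc w j) ^+ 2).

Lemma q_bounds w : 0 <= q w < 1.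
Proof.
rewrite sqrtr_ge0 /= -sqrtr1 ltr_sqrt ?ltr01 //; exact: zc_lt1.
Qed.

Lemma nr_col w k h :
  nr (\sum_j cj (zc w j) *: adj (V k) (C (V j.+1 h))) <= q w * nr h.
Proof.
have -> : \sum_(j < n) cj (zc w j) *: adj (V k) (C (V j.+1 h)) =
    adj (V k) (C (\sum_(j < n) cj (zc w j) *: V j.+1 h)).
  by rewrite !linear_sum; apply: eq_bigr => j _; rewrite !linearZ.
apply: le_trans (nr_adjV _ _) _; apply: le_trans (Cle _) _.
apply: ler_sq; first by rewrite mulr_ge0 ?nr_ge0 ?sqrtr_ge0.
rewrite exprMn sqr_sqrtr ?sumr_ge0 // => [|j _]; last exact: sqr_ge0.
rewrite -lecR -innerxx inner_suml mulr_suml rmorph_sum /=.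
rewrite le_eqVlt; apply/orP; left; apply/eqP; apply: eq_bigr => j _.
rewrite inner_sumr (bigD1 j) //= big1 ?addr0 => [|i ij].
  rewrite innerZl innerZr' VV eqxx mul1r cjK innerxx mulrA [cj _ * _]cjM_nr.
  by rewrite -rmorphM.
by rewrite innerZl innerZr' VV ord_neqS // mul0r !mulr0.
Qed.

Lemma nr_Zw w h : nr (Zw w h) <= q w * nr h.
Proof.
rewrite bsumE; under eq_bigr do rewrite bscaleE !bcompE; exact: nr_col.
Qed.

Lemma nr_Bw w h : nr (Bw w h) <= q w * nr h.
Proof.
rewrite bsumE; under eq_bigr do rewrite bscaleE !bcompE; exact: nr_col.
Qed.

Lemma ZT_ker w h : ZT (tens2 TG (ker H w) h) = tens2 TG (ker H w) (Zw w h).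
Proof.
rewrite !bsumE -[RHS]tensrE linear_sum; apply: eq_bigr => j _.
by rewrite bcompE SA_kert linearZ amprE tensrE bscaleE tens2Zr.
Qed.

Lemma BT_ker w h : BT (tens2 TG (ker H w) h) = tens2 TG (ker H w) (Bw w h).
Proof.
rewrite !bsumE -[RHS]tensrE linear_sum; apply: eq_bigr => j _.
by rewrite bcompE SA_kert linearZ amprE tensrE bscaleE tens2Zr.
Qed.

Lemma state_ex (r : R) w u : 0 <= r <= 1 -> exists h, h = c0 u + r%:C *: Zw w h.
Proof.
move=> /andP[r0 r1]; have /andP[q0 q1] := q_bounds w.
have [||h hh] := @neumann _ _ (bscale r%:C (Zw w)) (q w) _ _ (c0 u).
- exact: q_bounds.
- move=> x; rewrite bscaleE nrZ nrR ger0_norm //.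
  have := nr_Zw w x; have := nr_ge0 (Zw w x); nra.
by exists h; rewrite {1}hh bscaleE.
Qed.

Lemma state_uniq w u h h' : h = c0 u + Zw w h -> h' = c0 u + Zw w h' -> h = h'.
Proof.
move=> e e'; apply/eqP; rewrite -subr_eq0 -nr_eq0 eq_le nr_ge0 andbT.
have d : h - h' = Zw w (h - h').
  by rewrite (linearB (Zw w)) {1}e {1}e'; vring.
have := nr_Zw w (h - h'); rewrite -d; have := nr_ge0 (h - h').
have /andP[q0 q1] := q_bounds w; nra.
Qed.

(* The state of the realization for the shifts [r S_j]. *)
Lemma transfer_ex (r : R) : 0 <= r < 1 ->
  exists S : bop T TG,
    (forall xi, S xi = cT xi + r%:C *: ZT (S xi)) /\
    exists2 K, 0 <= K & forall xi, nr (S xi) <= K * nr xi.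
Proof.
move=> r01; have /andP[r0 r1] := r01.
have [|N hN] := @neumann_bop _ _ (bscale r%:C ZT) r r01.
  by move=> x; rewrite bscaleE nrZ nrR ger0_norm // ler_wpM2l // nr_ZT.
exists (bcomp N cT); split=> [xi|]; last exact: bopP.
by rewrite bcompE {1}hN bscaleE.
Qed.

Let rm (m : nat) : R := 1 - m.+1%:R^-1.

Lemma rm_bounds m : 0 <= rm m < 1.
Proof.
rewrite /rm subr_ge0 invf_le1 ?ltr0n // ler1n /= ltrBlDr ltrDl invr_gt0 ltr0n //.
Qed.

Let S m := sval (cid (transfer_ex (rm_bounds m))).
Let SP m := svalP (cid (transfer_ex (rm_bounds m))).
Let Phir m : bop T TG := badd aT (bscale (rm m)%:C (bcomp BT (S m))).

(** With [eta] the state [S m xi], the second term of [colligation] is [|S m xi|^2] and absorbs the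
    state on the right. The bound is uniform in [m], while the bound [K] of [S m] may depend on
    [m]. *)
Lemma nr_Phir m xi : nr (Phir m xi) <= nr xi.
Proof.
apply: ler_sq; first exact: nr_ge0.
rewrite baddE bscaleE bcompE.
have := colligation (rm m) xi (S m xi); rewrite -(SP m).1.
have /andP[r0 r1] := rm_bounds m.
have : rm m ^+ 2 * nr (S m xi) ^+ 2 <= nr (S m xi) ^+ 2.
  have : rm m ^+ 2 <= 1 by rewrite expr_le1 // ltW.
  have := sqr_ge0 (nr (S m xi)); nra.
move: (rm m ^+ 2 * _) => z; lra.
Qed.

(** Iterating the state equation [k] times from [0] yields polynomials [A k] in the adjoint shifts,
    within [r^k K] of [S m] in norm for [r = rm m < 1]. *)
Lemma Phir_spatial m : spatial_tensor TG T (multiplier_algebra H) (adj (Phir m)).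
Proof.
have /andP[r0 r1] := rm_bounds m; have [hS [K K0 hK]] := SP m.
pose A := fix A k : bop T TG :=
  if k is k'.+1 then badd cT (bscale (rm m)%:C (bcomp ZT (A k'))) else bop0 T TG.
have spanZ : adj_span ZT.
  by apply: adj_span_sum => j; apply: adj_span_comp; [exact: adj_span_ampr|exact: adj_span_SA].
have spanB : adj_span BT.
  by apply: adj_span_sum => j; apply: adj_span_comp; [exact: adj_span_ampr|exact: adj_span_SA].
have spanA k : adj_span (A k).
  elim: k => [|k IH] /=; first exact: adj_span0.
  apply: adj_spanD; first exact: adj_span_ampr.
  by apply: adj_spanZ; apply: adj_span_comp.
have dA k xi : nr (S m xi - A k xi) <= rm m ^+ k * (K * nr xi).
  elim: k => [|k IH]; first by rewrite subr0 expr0 mul1r; exact: hK.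
  have -> : S m xi - A k.+1 xi = (rm m)%:C *: ZT (S m xi - A k xi).
    rewrite {1}hS /= baddE bscaleE bcompE (linearB ZT); vring.
  rewrite nrZ nrR ger0_norm // exprS -mulrA ler_wpM2l //.
  exact: le_trans (nr_ZT _) IH.
move=> e e0.
have [e' e'0 ->] := gt0_complex e0.
have [k hk] : exists k, rm m ^+ k * K <= e'.
  have e1 : 0 < e' / (K + 1) by rewrite divr_gt0 // ltr_wpDl.
  have qn : `|rm m| < 1 by rewrite ger0_norm.
  have /cvgrPdist_lt /(_ _ e1)[k _ /(_ k (leqnn k)) /=] := cvg_expr qn.
  rewrite sub0r normrN ger0_norm ?exprn_ge0 // ltr_pdivlMr ?ltr_wpDl // => h.
  exists k; have := exprn_ge0 k r0; nra.
pose P := badd aT (bscale (rm m)%:C (bcomp BT (A k))).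
exists (adj P).
  apply: adj_spanD; first exact: adj_span_ampr.
  by apply: adj_spanZ; apply: adj_span_comp.
move=> x; rewrite !nrE -rmorphM lecR.
have -> : adj (Phir m) x - adj P x = adj (bsub (Phir m) P) x.
  by apply: inner_ext => z; rewrite innerBl !adjPl bsubE innerBr.
apply: adj_bound => [|xi]; first exact: ltW.
have -> : bsub (Phir m) P xi = (rm m)%:C *: BT (S m xi - A k xi).
  rewrite bsubE /Phir /P !(baddE, bscaleE, bcompE) (linearB BT); vring.
rewrite nrZ nrR ger0_norm //.
have h1 := nr_BT (S m xi - A k xi); have h2 := dA k xi.
have h3 := nr_ge0 (BT (S m xi - A k xi)).
apply: (@le_trans _ _ (nr (BT (S m xi - A k xi)))); first by nra.
apply: le_trans h1 _; apply: le_trans h2 _.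
by rewrite mulrA ler_wpM2r ?nr_ge0.
Qed.

Lemma symbol_ex (p : X * F) : exists e : G, exists h,
  h = c0 p.2 + Zw p.1 h /\ e = a0 p.2 + Bw p.1 h.
Proof.
have [|h hh] := @state_ex 1 p.1 p.2; first by rewrite ler01 lexx.
by exists (a0 p.2 + Bw p.1 h), h; split=> //; rewrite {1}hh scale1r.
Qed.

(** At [r = 1] the operator [ZT] is only known to be a contraction, which gives no Neumann series.
    On a kernel vector the state equation has ratio [|w| < 1]; this defines [Psi] there, and
    [colligation] applied to combinations makes it contractive. *)
Lemma transfer_limit_ex : exists Psi : bop T TG,
  (forall w u h, h = c0 u + Zw w h ->
     Psi (tens2 T (ker H w) u) = tens2 TG (ker H w) (a0 u + Bw w h)) /\
  forall x, nr (Psi x) <= nr x.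
Proof.
have [e he] := choice symbol_ex; have [h hh] := choice (fun p => he p).
pose s (p : X * F) := tens2 TG (ker H p.1) (e p).
pose t (p : X * F) := tens2 TG (ker H p.1) (h p).
have [||Psi [hPsi bPsi]] := @extension _ _ _ _ (kert T) s 1 (@kert_total _ _ _ _ T).
- exact: ler01.
- move=> l; rewrite mul1r; apply: ler_sq; first exact: nr_ge0.
  have := colligation 1 (comb (kert T) l) (comb t l).
  rewrite !linear_comb !scale1r expr1n mul1r.
  have combD (W : hilbertType R) (f g : X * F -> W) :
      comb f l + comb g l = comb (fun p => f p + g p) l.
    by rewrite /comb -big_split; apply: eq_bigr => p _; rewrite scalerDr.
  rewrite !combD.
  have -> : comb (fun p => cT (kert T p) + ZT (t p)) l = comb t l.
    apply: eq_bigr => p _; congr (_ *: _).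
    by rewrite /kert /t ZT_ker amprE -tens2Dr; have [h1 _] := hh p.2; rewrite -h1.
  have -> : comb (fun p => aT (kert T p) + BT (t p)) l = comb s l.
    apply: eq_bigr => p _; congr (_ *: _).
    by rewrite /kert /t /s BT_ker amprE -tens2Dr; have [_ h2] := hh p.2; rewrite -h2.
  lra.
exists Psi; split=> [w u g hg|x]; last by have := bPsi x; rewrite mul1r.
have := hPsi (w, u); rewrite /kert /s /= => ->; have [h1 ->] := hh (w, u).
by rewrite (state_uniq h1 hg).
Qed.

Lemma Phir_limit (Psi : bop T TG) :
  (forall w u h, h = c0 u + Zw w h ->
     Psi (tens2 T (ker H w) u) = tens2 TG (ker H w) (a0 u + Bw w h)) ->
  (forall x, nr (Psi x) <= nr x) ->
  forall x (e : R), 0 < e -> exists N, forall m, (N <= m)%N ->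
    nr (Psi x - Phir m x) <= e.
Proof.
move=> hPsi bPsi x.
have [|cl_ cl0 clD clZ] := @pointwise_zero _ _ _ (fun m => bsub Psi (Phir m)) 2 (ler0n _ 2).
  move=> m y; rewrite bsubE; apply: le_trans (nrD _ _) _; rewrite nrN.
  by have := bPsi y; have := nr_Phir m y; lra.
move: (And4 cl_ cl0 clD clZ) => cl.
suff hk p : [set y | forall e : R, 0 < e ->
    exists N, forall m, (N <= m)%N -> nr (bsub Psi (Phir m) y) <= e] (kert T p).
  have h := total_subspace (@kert_total _ _ _ _ T) cl hk x.
  by move=> e e0; have [N hN] := h e e0; exists N => m /hN; rewrite bsubE.
case: p => w u /= e e0 {cl cl_ cl0 clD clZ x}.
have [|h hh] := @state_ex 1 w u; first by rewrite ler01 lexx.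
rewrite scale1r in hh; have /andP[q0 q1] := q_bounds w.
(* For the states [h] at radius [1] and [g] at radius [r], [|h - g| <= (1 - r) |h| / (1 - |w|)] and
   [h - r g = r (h - g) + (1 - r) h], so the error is at most [K (1 - r)], with
   [1 - r = 1 / (m + 1)]. *)
pose K := nr (ker H w) * (nr h / (1 - q w) + nr h).
have p0 : 0 < 1 - q w by lra.
have K0 : 0 <= K by rewrite mulr_ge0 ?addr_ge0 ?divr_ge0 ?nr_ge0 ?ltW.
have K1 : 0 < K + 1 by lra.
have [N hN] := inv_small (divr_gt0 e0 K1); exists N => m /hN.
rewrite ler_pdivlMr // => hm; apply: le_trans hm.
have /andP[r0 r1] := rm_bounds m.
have [|g hg] := @state_ex (rm m) w u; first by rewrite r0 ltW.
have Sg : S m (tens2 T (ker H w) u) = tens2 TG (ker H w) g.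
  apply/eqP; rewrite -subr_eq0 -nr_eq0 eq_le nr_ge0 andbT.
  set d := _ - _; have dE : d = (rm m)%:C *: ZT d.
    rewrite /d {1}(SP m).1 (linearB ZT) ZT_ker amprE {1}hg tens2Dr tens2Zr; vring.
  have := nr_ZT d; have : nr d = rm m * nr (ZT d) by rewrite {1}dE nrZ nrR ger0_norm.
  have := nr_ge0 d; nra.
rewrite bsubE /kert /= (hPsi w u h hh) baddE bscaleE bcompE Sg BT_ker amprE.
have -> : tens2 TG (ker H w) (a0 u + Bw w h) - (tens2 TG (ker H w) (a0 u) +
    (rm m)%:C *: tens2 TG (ker H w) (Bw w g)) =
    tens2 TG (ker H w) (Bw w (h - (rm m)%:C *: g)).
  rewrite (linearB (Bw w)) [in RHS]linearZ -[in RHS]scaleN1r !tens2Dr !tens2Zr; vring.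
rewrite nr_tens2; set r := rm m in hg r0 r1 *.
have e1 : m.+1%:R^-1 = 1 - r by rewrite /r /rm; ring.
clearbody r; rewrite e1.
have e2 : (1 - r)%:C = 1 - r%:C :> R[i] by rewrite rmorphB.
have dE : h - g = r%:C *: Zw w (h - g) + (1 - r)%:C *: Zw w h.
  rewrite (linearB (Zw w)) {1}hh {1}hg.
  rewrite e2; move: (r%:C) (Zw w h) (Zw w g) (c0 u) => r' a b c; vring.
have hd : nr (h - g) <= (1 - r) * (nr h / (1 - q w)).
  rewrite mulrA ler_pdivlMr //.
  have : nr (h - g) <= r * nr (Zw w (h - g)) + (1 - r) * nr (Zw w h).
    rewrite {1}dE; apply: le_trans (nrD _ _) _.
    by rewrite !nrZ !nrR !ger0_norm // subr_ge0 ltW.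
  have := nr_Zw w (h - g); have := nr_Zw w h.
  have := nr_ge0 (h - g); have := nr_ge0 h.
  have := nr_ge0 (Zw w (h - g)); have := nr_ge0 (Zw w h).
  move: (nr (Zw w (h - g))) (nr (Zw w h)) (nr (h - g)) (nr h) (q w) q0 q1 => a b c d q' q0 q1.
  have r1' : 0 <= 1 - r by rewrite subr_ge0 ltW.
  move=> b0' a0' d0' c0' bd ac cc.
  have h1 : 0 <= (1 - r) * a by exact: mulr_ge0.
  have h2 : 0 <= (1 - r) * (q' * d - b) by rewrite mulr_ge0 // subr_ge0.
  have h3 : 0 <= (1 - r) * ((1 - q') * d) by rewrite !mulr_ge0 // subr_ge0 ltW.
  move: (r) h1 h2 h3 cc => s; lra.
have : nr (Bw w (h - r%:C *: g)) <= (1 - r) * (nr h / (1 - q w) + nr h).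
  apply: (@le_trans _ _ (nr (h - r%:C *: g))).
    have := nr_Bw w (h - r%:C *: g); have := nr_ge0 (h - r%:C *: g); nra.
  have -> : h - r%:C *: g = r%:C *: (h - g) + (1 - r)%:C *: h.
    by rewrite e2; vring.
  apply: le_trans (nrD _ _) _; rewrite !nrZ !nrR !ger0_norm ?(ltW r0) //; last by rewrite subr_ge0 ltW.
  rewrite mulrDr lerD2r; apply: le_trans hd; have := nr_ge0 (h - g); nra.
move=> h1; rewrite /K.
apply: (@le_trans _ _ (nr (ker H w) * ((1 - r) * (nr h / (1 - q w) + nr h)))).
  by rewrite ler_wpM2l ?nr_ge0.
by rewrite mulrCA; apply: ler_wpM2l; rewrite ?subr_ge0 ?ltW // ltrDl ltr01.
Qed.

(** The state equation determines [h], as [|w| < 1]; hence it suffices to exhibit one solution in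
    closed form to know the adjoint on a kernel vector. *)
Theorem realization : exists Phi : bop TG T,
  weak_tensor TG T (multiplier_algebra H) Phi /\
  forall w u h e,
    h = adj (V 1) (C (row_in u (fun j => cj (zc w j) *: h))) ->
    e = adj (V 0) (C (row_in u (fun j => cj (zc w j) *: h))) ->
    adj Phi (tens2 T (ker H w) u) = tens2 TG (ker H w) e.
Proof.
have [Psi [hPsi bPsi]] := transfer_limit_ex.
exists (adj Psi); split; last first.
  have row k w u h : adj (V k) (C (row_in u (fun j => cj (zc w j) *: h))) =
      bcomp (adj (V k)) (bcomp C iota) u +
      \sum_j bscale (cj (zc w j)) (bcomp (adj (V k)) (bcomp C (V (nat_of_ord j).+1))) h.
    rewrite /row_in !linearD !linear_sum !bcompE; congr (_ + _).
    by apply: eq_bigr => j _; rewrite bscaleE !bcompE !linearZ.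
  move=> w u h e; rewrite !row -!bsumE => hh ->; rewrite adjK.
  exact: hPsi.
(* Weak closeness involves finitely many vectors, so strong convergence of [Phir m] to [Psi] at the
   [y l] suffices. *)
move=> e N x y e0.
have [e' e'0 ->] := gt0_complex e0.
have hl (l : 'I_N) : exists M, forall m, (M <= m)%N ->
    nr (Psi (y l) - Phir m (y l)) <= e' / (nr (x l) + 1) / 2.
  apply: Phir_limit => //; rewrite !divr_gt0 // ltr_wpDl ?nr_ge0 //.
have [M hM] := choice hl; pose m := \max_l M l.
exists (adj (Phir m)); first exact: Phir_spatial.
move=> l; rewrite nrE ltcR.
have -> : inner (adj Psi (x l) - adj (Phir m) (x l)) (y l) =
    inner (x l) (Psi (y l) - Phir m (y l)).
  by rewrite innerBl !adjPl innerBr.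
apply: le_lt_trans (cauchy_schwarz _ _) _.
have x1 : 0 < nr (x l) + 1 by rewrite ltr_wpDl ?nr_ge0.
have := hM l m (leq_bigmax l); set z := nr (_ - _) => hz.
have : z * (nr (x l) + 1) <= e' / 2.
  by rewrite -ler_pdivlMr // mulrAC.
have := nr_ge0 (x l); have z0 : 0 <= z := nr_ge0 _; nra.
Qed.

End Realization.

(** * Beurling's theorem and lifting of commuting operators *)

Section Beurling.
Variables (R : realType) (n : nat) (H : drury_arveson R n).
Variables (F : hilbertType R) (T : tensor2 H F) (TE : tensor2 H T).
Variable V : nat -> bop T T.
Hypothesis VV : forall i j x y, inner (V i x) (V j y) = (i == j)%:R * inner x y.
Variables (M : set T) (hM : is_closed_subspace M).
Hypothesis MSA : forall j x, M x -> M (adj (SA T j) x).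

Let P : bop T T := sval (cid (proj_ex hM)).

Lemma PM x : M (P x). Proof. exact: (svalP (cid (proj_ex hM))).1. Qed.

Lemma Porth x m : M m -> inner (x - P x) m = 0.
Proof. exact: (svalP (cid (proj_ex hM))).2. Qed.

Lemma P_sym x y : inner (P x) y = inner (P x) (P y).
Proof.
apply/eqP; rewrite -subr_eq0 -innerBr inner_cj Porth ?cj0 //; exact: PM.
Qed.

Lemma P_adj x y : inner (P x) y = inner x (P y).
Proof. rewrite (inner_cj (P y) x) (P_sym y x) -inner_cj; exact: P_sym. Qed.

Lemma P_id x : M x -> P x = x.
Proof.
move=> Mx; have [_ _ MD MZ] := hM; apply/esym/eqP; rewrite -subr_eq0; apply/eqP/inner_eq0.
by apply: Porth; rewrite -scaleN1r; apply/MD/MZ/PM.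
Qed.

Lemma nr_P x : nr (P x) ^+ 2 = complex.Re (inner (P x) x).
Proof. by rewrite nr_sqE -P_sym. Qed.

Lemma nr_P_compl x : nr (x - P x) ^+ 2 = nr x ^+ 2 - nr (P x) ^+ 2.
Proof.
have h : inner (x - P x) (P x) = 0 by apply: Porth; exact: PM.
by have := pythagoras h; rewrite subrK => ->; rewrite addrK.
Qed.

Lemma nr_P_le x : nr (P x) <= nr x.
Proof.
apply: ler_sq; first exact: nr_ge0.
by have := sqr_ge0 (nr (x - P x)); rewrite nr_P_compl subr_ge0.
Qed.

Lemma P_coinv (A : bop T T) x : (forall m, M m -> M (adj A m)) -> P (A x) = P (A (P x)).
Proof.
move=> hA; apply: inner_ext => z.
apply/eqP; rewrite -subr_eq0 -innerBl -!linearB P_adj adjP Porth //.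
exact/hA/PM.
Qed.

Let D : bop T T := bsub P (bsum (fun j => bcomp (adj (SA T j)) (bcomp P (SA T j)))).

Lemma DE x y : inner (D x) y = inner (P x) y - \sum_j inner (P (SA T j x)) (SA T j y).
Proof.
rewrite bsubE bsumE innerBl inner_suml; congr (_ - _); apply: eq_bigr => j _.
by rewrite !bcompE adjPl.
Qed.

Lemma D_pos : unit_pos D.
Proof.
split=> [x y|x].
  rewrite DE [RHS]inner_cj DE cjD cjN -inner_cj P_adj; congr (_ - _).
  rewrite [RHS]cj_sum; apply: eq_bigr => j _.
  by rewrite -inner_cj P_adj.
rewrite DE raddfB raddf_sum /= -nr_P.
under eq_bigr do rewrite -nr_P.
have : \sum_j nr (P (SA T j x)) ^+ 2 <= nr (P x) ^+ 2.
  (* Invariance of [M] gives [P S_j' = P S_j' P], and the [S_j'] form a column contraction. *)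
  apply: (@le_trans _ _ (\sum_j nr (SA T j (P x)) ^+ 2)).
    apply: ler_sum => j _; rewrite P_coinv; last by move=> m; apply: MSA.
    by rewrite ler_pXn2r ?nnegrE ?nr_ge0 // nr_P_le.
  by rewrite row_norm lerBlDr lerDl sqr_ge0.
have : 0 <= \sum_j nr (P (SA T j x)) ^+ 2 by apply: sumr_ge0 => j _; rewrite sqr_ge0.
have : nr (P x) ^+ 2 <= nr x ^+ 2 by rewrite ler_pXn2r ?nnegrE ?nr_ge0 // nr_P_le.
move: (\sum_j _) (nr (P x) ^+ 2) (nr x ^+ 2) => a b c ? ? ?; lra.
Qed.

Let L : bop T T := sval (cid (sqrt_ex VV D_pos)).

Lemma LE x y : inner (L x) (L y) = inner (D x) y.
Proof. exact: (svalP (cid (sqrt_ex VV D_pos))). Qed.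

Lemma nr_L x : nr (L x) ^+ 2 = nr (P x) ^+ 2 - \sum_j nr (P (SA T j x)) ^+ 2.
Proof.
rewrite nr_sqE LE DE raddfB raddf_sum /= -nr_P; congr (_ - _).
by apply: eq_bigr => j _; rewrite -nr_P.
Qed.

Lemma nr_V_sum (m : nat) (f : 'I_m -> T) (i : nat -> nat) : injective i ->
  nr (\sum_(j < m) V (i j) (f j)) ^+ 2 = \sum_j nr (f j) ^+ 2.
Proof.
move=> inj; apply: (@complexI R); rewrite rmorph_sum /= -innerxx inner_suml.
apply: eq_bigr => j _; rewrite inner_sumr (bigD1 j) //= big1 ?addr0 => [|l lj].
  by rewrite VV eqxx mul1r innerxx.
by rewrite VV (inj_eq inj) eq_sym (negbTE (_ : l != j :> nat)) ?mul0r.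
Qed.

Lemma nr_V_row (u : T) (f : 'I_n -> T) :
  nr (V 0 u + \sum_(j < n) V j.+1 (f j)) ^+ 2 = nr u ^+ 2 + \sum_j nr (f j) ^+ 2.
Proof.
rewrite pythagoras; last by rewrite inner_sumr big1 // => j _; rewrite VV mul0r.
rewrite (nr_V_sum f succn_inj); congr (_ + _).
by rewrite !nr_sqE VV mul1r.
Qed.

Lemma nr_V_pair (u v : T) : nr (V 0 u + V 1 v) ^+ 2 = nr u ^+ 2 + nr v ^+ 2.
Proof. by rewrite pythagoras ?VV ?mul0r // !nr_sqE !VV !mul1r. Qed.

Lemma adjV_pair (u v : T) : adj (V 0) (V 0 u + V 1 v) = u /\ adj (V 1) (V 0 u + V 1 v) = v.
Proof.
by split; apply: inner_ext => z; rewrite adjPl innerDl !VV mul0r mul1r ?addr0 ?add0r.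
Qed.

Lemma theta_ex : exists Theta : bop TE T,
  weak_tensor TE T (multiplier_algebra H) Theta /\
  forall w y, adj Theta (tens2 T (ker H w) y) = tens2 TE (ker H w) (L (tens2 T (ker H w) y)).
Proof.
(* Slot [0] of a row holds the input [y] as [V 0 (1 (x) y)]; the slots [j.+1] hold the states. *)
pose iota := bcomp (V 0) (kap T).
have iotaI x y : inner (iota x) (iota y) = inner x y.
  by rewrite /iota !bcompE VV /kap !tensrE tens2_inner inner_ker_one !mul1r.
have iotaV j x y : inner (iota x) (V j.+1 y) = 0.
  by rewrite /iota bcompE VV mul0r.
pose Ga := bsub (bop1 T) P.
have GaE x : Ga x = x - P x by rewrite bsubE.
pose Q := badd (bcomp iota (adj (kap T))) (bsum (fun j : 'I_n => bcomp (V j.+1) (bcomp Ga (SA T j)))).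
pose S := badd (bcomp (V 0) L) (bcomp (V 1) Ga).
have QE x : Q x = V 0 (kap T (adj (kap T) x)) + \sum_(j < n) V j.+1 (Ga (SA T j x)).
  rewrite baddE bsumE /iota !bcompE; congr (_ + _); apply: eq_bigr => j _.
  by rewrite !bcompE.
have SE x : S x = V 0 (L x) + V 1 (Ga x) by rewrite baddE !bcompE.
have [|C [hC Cle]] := @douglas _ _ _ _ Q S.
  move=> x; apply: ler_sq; first exact: nr_ge0.
  (* Both sides are equal: the terms in [P] cancel, leaving
     [|x|^2 - sum_j |S_j' x|^2 = |k_0' x|^2]. *)
  rewrite QE SE nr_V_row nr_V_pair nr_L GaE nr_P_compl.
  under [in leRHS]eq_bigr do rewrite GaE nr_P_compl.
  rewrite sumrB row_norm /kap tensrE nr_tens2 nr_one mul1r.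
  by rewrite le_eqVlt; apply/orP; left; apply/eqP; ring.
have [Theta [wT hT]] := realization T TE VV iotaI iotaV Cle.
exists Theta; split=> // w y; set x := tens2 T (ker H w) y.
(* [S_j'] multiplies [x] by [conj w_j], so [Q x] is the row with input [y] and state [Ga x]; then
   [C (Q x) = S x] says that [Ga x] solves the state equation, with output [L x]. *)
have row : row_in V iota y (fun j : 'I_n => cj (zc w j) *: Ga x) = Q x.
  rewrite QE /row_in /iota bcompE /x adj_kap; congr (_ + _); apply: eq_bigr => j _.
  by rewrite SA_kert !linearZ.
apply: (hT w y (Ga x)); rewrite row hC SE.
  by rewrite (adjV_pair _ _).2.
by rewrite (adjV_pair _ _).1.
Qed.

Section Theta.
Variable Theta : bop TE T.
Hypothesis adjT : forall w y,
  adj Theta (tens2 T (ker H w) y) = tens2 TE (ker H w) (L (tens2 T (ker H w) y)).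

Lemma theta_coisometry x : Theta (adj Theta x) = P x.
Proof.
rewrite -bcompE; apply: (bop_ext (@kert_total _ _ _ _ T)) => -[w y].
apply: (total_ext (@kert_total _ _ _ _ T)) => -[v y'].
rewrite bcompE adjP /kert /= !adjT tens2_inner LE DE.
under eq_bigr do rewrite !SA_kert linearZ innerZl innerZr' cjK mulrA.
set p := inner (P _) _.
(* The factor [1 - <z, w>] cancels the kernel, so [Theta Theta'] and [P] have the same entries on
   kernel vectors. *)
have -> : p - \sum_i cj (zc w i) * zc v i * p = (1 - \sum_j zc v j * cj (zc w j)) * p.
  rewrite mulrBl mul1r mulr_suml; congr (_ - _); apply: eq_bigr => j _.
  by rewrite (mulrC (cj _)).
by rewrite inner_ker mulrA mulVf ?mul1r // kernel_neq0.
Qed.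

(** For [z] orthogonal to [M], [Theta Theta' z = P z = 0] forces [Theta' z = 0], so the range of
    [Theta] has no component orthogonal to [M]. *)
Lemma theta_in x : M (Theta x).
Proof.
have -> : Theta x = P (Theta x); last exact: PM.
apply/eqP; rewrite -subr_eq0; apply/eqP/inner_eq0.
set z := _ - _.
have zM m : M m -> inner z m = 0 by apply: Porth.
have Pz : P z = 0 by apply: inner_eq0; rewrite -P_sym P_adj zM //; exact: PM.
have Tz : adj Theta z = 0.
  by apply: inner_eq0; rewrite adjPl theta_coisometry Pz inner0r.
by rewrite {1}/z innerBl adjP Tz inner0r (inner_cj z) zM ?cj0 ?subrr //; exact: PM.
Qed.

Lemma theta_range : M = range Theta.
Proof.
apply/seteqP; split=> [m Mm|_ [x _ <-]]; last exact: theta_in.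
by exists (adj Theta m) => //; rewrite theta_coisometry P_id.
Qed.

Lemma theta_partial_isometry : is_partial_isometry Theta.
Proof.
move=> x hx; pose d := adj Theta (Theta x) - x.
have Td : Theta d = 0.
  by rewrite linearB theta_coisometry P_id ?subrr //; exact: theta_in.
have d0 : d = 0.
  by apply: inner_eq0; rewrite {1}/d innerBl (hx _ Td) subr0 adjPl Td inner0r.
have e : adj Theta (Theta x) = x by apply/eqP; rewrite -subr_eq0 -/d d0.
rewrite !nrE; congr (_%:C); apply/eqP.
by rewrite -(eqrXn2 (n := 2)) ?nr_ge0 // !nr_sqE -adjPl e.
Qed.

(* [k_w (x) y |-> k_w (x) L X^* (k_w (x) y)] has to be factored through
   [Theta^*]: the kernel [P - Y^* P Y >= 0], with [Y = X^* / c], provides the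
   state space of the realization. *)
Lemma phi_ex (X : bop T T) (B : bop F F) (c : R) :
  0 < c -> (forall x, nr (X x) <= c * nr x) ->
  (forall x y, X (tens2 T x y) = tens2 T x (B y)) -> (forall m, M m -> M (X m)) ->
  exists Phi : bop TE TE, weak_tensor TE TE (multiplier_algebra H) Phi /\
    forall x, X (Theta x) = Theta (c%:C *: Phi x).
Proof.
move=> c0 Xc XB XM.
pose Y := bscale c^-1%:C (adj X).
have Yle x : nr (Y x) <= nr x.
  rewrite bscaleE nrZ nrR ger0_norm ?invr_ge0 ?(ltW c0) // ler_pdivrMl //.
  by apply: adj_bound => //; exact: ltW.
have YM m : M m -> M (adj Y m).
  have -> : adj Y m = c^-1%:C *: X m.
    apply: inner_ext => z; rewrite adjPl bscaleE innerZr' cj_real innerZl; congr (_ * _).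
    by rewrite -adjP.
  by have [_ _ _ MZ] := hM => /XM; apply: MZ.
(* The form [I (x) B] of [X] enters here: [Y] keeps the factor [k_w], on which the [S_j'] are
   scalar, and so commutes with them. *)
have YB w y : exists y', Y (tens2 T (ker H w) y) = tens2 T (ker H w) y'.
  exists (c^-1%:C *: adj B y); rewrite bscaleE tens2Zr; congr (_ *: _).
  apply: (total_ext (@elem_total _ _ _ T)) => -[x z].
  by rewrite /elem adjPl /= XB !tens2_inner adjPl.
have YSA j x : SA T j (Y x) = Y (SA T j x).
  rewrite -!bcompE; apply: (bop_ext (@kert_total _ _ _ _ T)) => -[w y].
  have [y' hy] := YB w y.
  by rewrite /kert /= !bcompE hy !SA_kert linearZ hy.
pose De := bsub P (bcomp (adj Y) (bcomp P Y)).
have Depos : unit_pos De.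
  split=> [x y|x].
    rewrite !bsubE !bcompE innerBl innerBr P_adj; congr (_ - _).
    by rewrite adjPl -adjP P_adj.
  rewrite bsubE !bcompE innerBl adjPl raddfB /= -!nr_P P_coinv //.
  have h1 : nr (P (Y (P x))) ^+ 2 <= nr (P x) ^+ 2.
    by rewrite ler_pXn2r ?nnegrE ?nr_ge0 //; apply: le_trans (nr_P_le _) (Yle _).
  have h2 : nr (P x) ^+ 2 <= nr x ^+ 2 by rewrite ler_pXn2r ?nnegrE ?nr_ge0 ?nr_P_le.
  by have h3 := sqr_ge0 (nr (P (Y (P x)))); apply/andP; split; lra.
have [Ga hGa] := sqrt_ex VV Depos.
have nr_Ga x : nr (Ga x) ^+ 2 = nr (P x) ^+ 2 - nr (P (Y x)) ^+ 2.
  by rewrite nr_sqE hGa bsubE !bcompE innerBl adjPl raddfB /= -!nr_P.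
pose Q := badd (bcomp (V 0) L) (bsum (fun j : 'I_n => bcomp (V j.+1) (bcomp Ga (SA T j)))).
pose S := badd (bcomp (V 0) (bcomp L Y)) (bcomp (V 1) Ga).
have QE x : Q x = V 0 (L x) + \sum_(j < n) V j.+1 (Ga (SA T j x)).
  rewrite baddE bsumE !bcompE; congr (_ + _); apply: eq_bigr => j _.
  by rewrite !bcompE.
have SE x : S x = V 0 (L (Y x)) + V 1 (Ga x) by rewrite baddE !bcompE.
have [|C [hC Cle]] := @douglas _ _ _ _ Q S.
  move=> x; apply: ler_sq; first exact: nr_ge0.
  rewrite QE SE nr_V_row nr_V_pair !nr_L nr_Ga.
  (* As [Y] commutes with the [S_j'], the terms [|P S_j' Y x|^2] arising from [L Y x] and from
     [Ga S_j' x] agree. *)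
  have -> : \sum_j nr (Ga (SA T j x)) ^+ 2 =
      \sum_j nr (P (SA T j x)) ^+ 2 - \sum_j nr (P (SA T j (Y x))) ^+ 2.
    by rewrite -sumrB; apply: eq_bigr => j _; rewrite nr_Ga YSA.
  by rewrite le_eqVlt; apply/orP; left; apply/eqP; ring.
have V0I x y : inner (V 0 x) (V 0 y) = inner x y by rewrite VV mul1r.
have V0V j x y : inner (V 0 x) (V j.+1 y) = 0 by rewrite VV mul0r.
have [Phi [wPhi hPhi]] := realization TE TE VV V0I V0V Cle.
exists Phi; split=> // x.
have adjPhi z : adj Phi (adj Theta z) = adj Theta (Y z).
  rewrite -!bcompE; apply: (bop_ext (@kert_total _ _ _ _ T)) => -[w y].
  rewrite !bcompE /kert /=; set v := tens2 T (ker H w) y.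
  have [y' hy] := YB w y; rewrite hy !adjT -/v.
  have row : row_in V (V 0) (L v) (fun j : 'I_n => cj (zc w j) *: Ga v) = Q v.
    rewrite QE /row_in; congr (_ + _); apply: eq_bigr => j _.
    by rewrite SA_kert !linearZ.
  apply: (hPhi w (L v) (Ga v)); rewrite row hC SE.
    by rewrite (adjV_pair _ _).2.
  by rewrite (adjV_pair _ _).1 -hy.
apply: inner_ext => z; rewrite adjP linearZ innerZl adjP.
rewrite [RHS](_ : _ = c%:C * inner x (adj Phi (adj Theta z))); last first.
  by rewrite -!adjP.
by rewrite adjPhi bscaleE linearZ innerZr' cj_real mulrA -rmorphM divff ?gt_eqF // rmorph1 mul1r.
Qed.

End Theta.

Lemma weak_tensorZ (E1 E2 : hilbertType R) (T1 : tensor2 H E1) (T2 : tensor2 H E2)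
    (S : set (bop H H)) (c : R) (A : bop T1 T2) : 0 < c ->
  weak_tensor T1 T2 S A -> weak_tensor T1 T2 S (bscale c%:C A).
Proof.
move=> c0 wA e N x y e0.
have cC : (0 : R[i]) < c%:C by rewrite ltcR.
have [A' sA' hA'] := wA (e / c%:C) N x y (divr_gt0 e0 cC).
exists (bscale c%:C A').
  move=> d d0; have [A'' [m [a [C [hC hA'']]]] dA] := sA' (d / c%:C) (divr_gt0 d0 cC).
  exists (bscale c%:C A'').
    exists m, (fun l => c%:C * a l), C; split=> // z.
    by rewrite bscaleE hA'' scaler_sumr; apply: eq_bigr => l _; rewrite scalerA.
  move=> z; rewrite !bscaleE -scalerBr normrZ (gtr0_norm cC).
  by apply: le_trans (ler_wpM2l (ltW cC) (dA z)) _; rewrite mulrA mulrCA mulfV ?mulr1 ?gt_eqF.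
move=> l; rewrite !bscaleE -scalerBr innerZl normrM (gtr0_norm cC).
by have := hA' l; rewrite ltr_pdivlMr // mulrC.
Qed.

Theorem beurling : exists Theta : bop TE T,
  [/\ is_partial_isometry Theta, weak_tensor TE T (multiplier_algebra H) Theta,
      M = range Theta
    & forall (X : bop T T) (B : bop F F),
        (forall x y, X (tens2 T x y) = tens2 T x (B y)) -> (forall m, M m -> M (X m)) ->
        exists Phi : bop TE TE, weak_tensor TE TE (multiplier_algebra H) Phi /\
          forall x, X (Theta x) = Theta (Phi x)].
Proof.
have [Theta [wT hT]] := theta_ex; exists Theta; split=> //.
- exact: theta_partial_isometry.
- exact: theta_range.
move=> X B XB XM; have [c c0 Xc] := bopP X.
(* [bopP] only gives [c >= 0], while [phi_ex] divides by its bound. *)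
have c1 : 0 < c + 1 by lra.
have [|Phi [wPhi hPhi]] := phi_ex hT c1 _ XB XM.
  by move=> x; apply: le_trans (Xc x) _; rewrite ler_wpM2r ?nr_ge0 // lerDl.
exists (bscale (c + 1)%:C Phi); split; first exact: weak_tensorZ.
by move=> x; rewrite bscaleE hPhi.
Qed.

End Beurling.

(** * Coordinate operators *)

Section Submodule.
Variable R : realType.

(** Elementary operators satisfy this because multipliers commute. The two sides are compared
    through matrix entries, which involve two pairs of vectors and a common approximant, so the
    identity survives norm limits and then weak limits. *)
Lemma weak_tensor_comm (n : nat) (H : drury_arveson R n) (E F : hilbertType R)
    (TE : tensor2 H E) (TF : tensor2 H F) (Theta : bop TE TF) j :
  weak_tensor TE TF (multiplier_algebra H) Theta ->
  forall x, Theta (adj (SA TE j) x) = adj (SA TF j) (Theta x).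
Proof.
move=> wT.
have elemC C : elementary_ops TE TF (multiplier_algebra H) C ->
    forall x, C (adj (SA TE j) x) = adj (SA TF j) (C x).
  move=> [A [B [[phi _ mA] hC]]] x; rewrite -!bcompE.
  apply: (bop_ext (@elem_total _ _ _ TE)) => -[u v].
  rewrite /elem !bcompE ampl_adj !hC ampl_adj; congr tens2.
  apply: (@rk_eval_inj _ _ _ H); apply/funext => z.
  by rewrite /= -/(sh H j) mA !sh_eval mA mulrCA.
have spanC A : op_span (elementary_ops TE TF (multiplier_algebra H)) A ->
    forall x, A (adj (SA TE j) x) = adj (SA TF j) (A x).
  move=> [N [a [C [hC hA]]]] x; rewrite !hA linear_sum; apply: eq_bigr => l _.
  by rewrite linearZ elemC.
have approx (A : bop TE TF) x y (S : set (bop TE TF)) :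
    (forall B, S B -> inner (B (adj (SA TE j) x)) y = inner (B x) (SA TF j y)) ->
    (forall e : R, 0 < e -> exists2 B, S B &
       nr (inner (A (adj (SA TE j) x) - B (adj (SA TE j) x)) y) <= e /\
       nr (inner (A x - B x) (SA TF j y)) <= e) ->
    inner (A (adj (SA TE j) x)) y = inner (A x) (SA TF j y).
  move=> hS hA; apply/eqP; rewrite -subr_eq0; apply/eqP/nr_small => e e0.
  have [B SB [h1 h2]] := hA _ (divr_gt0 e0 (ltr0n _ 2)).
  have -> : inner (A (adj (SA TE j) x)) y - inner (A x) (SA TF j y) =
    inner (A (adj (SA TE j) x) - B (adj (SA TE j) x)) y - inner (A x - B x) (SA TF j y).
    by rewrite !innerBl (hS _ SB); ring.
  by apply: le_trans (nrD _ _) _; rewrite nrN; lra.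
have normC A : spatial_tensor TE TF (multiplier_algebra H) A ->
    forall x y, inner (A (adj (SA TE j) x)) y = inner (A x) (SA TF j y).
  move=> sA x y; apply: (approx _ _ _ (op_span (elementary_ops TE TF (multiplier_algebra H)))).
    by move=> B /spanC ->; rewrite adjPl.
  move=> e e0; pose K := nr (adj (SA TE j) x) * nr y + nr x * nr (SA TF j y).
  have K0 : 0 <= K by rewrite addr_ge0 // mulr_ge0 ?nr_ge0.
  have K1 : 0 < K + 1 by lra.
  have e1 : (0 : R[i]) < (e / (K + 1))%:C by rewrite ltcR divr_gt0.
  have [B sB hB] := sA _ e1; exists B => //.
  have gen z t : nr z * nr t <= K -> nr (inner (A z - B z) t) <= e.
    move=> zt; apply: le_trans (cauchy_schwarz _ _) _.
    have := hB z; rewrite !nrE -rmorphM lecR => /(ler_wpM2r (nr_ge0 t)) h.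
    apply: le_trans h _; rewrite -mulrA mulrAC ler_pdivrMr // ler_wpM2l ?(ltW e0) //; lra.
  have p1 : 0 <= nr (adj (SA TE j) x) * nr y by rewrite mulr_ge0 ?nr_ge0.
  have p2 : 0 <= nr x * nr (SA TF j y) by rewrite mulr_ge0 ?nr_ge0.
  by split; apply: gen; rewrite /K; lra.
move=> x; apply: inner_ext => y; rewrite adjPl.
apply: (approx _ _ _ (spatial_tensor TE TF (multiplier_algebra H))).
  by move=> B /normC.
move=> e e0; have e1 : (0 : R[i]) < e%:C by rewrite ltcR.
pose xs (i : 'I_2) := if i == ord0 then adj (SA TE j) x else x.
pose ys (i : 'I_2) := if i == ord0 then y else SA TF j y.
have [B sB hB] := wT _ _ xs ys e1; exists B => //.
have := hB ord0; have := hB (lift ord0 ord0); rewrite /xs /ys /=.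
by rewrite !nrE !ltcR => /ltW h2 /ltW h1.
Qed.

Variables (k : nat) (n : 'I_k.+1 -> nat) (H : forall i, drury_arveson R (n i)).
Variables (En : tensorn (fun i : 'I_k => H (lift ord0 i))).
Variable T : tensor2 (H ord0) En.

Lemma tens_total (I : finType) (G : I -> hilbertType R) (TG : tensorn G) : total (tens TG).
Proof.
by apply: (dense_total (@tens_dense _ _ _ TG)) => v [f ->]; exists f.
Qed.

Lemma tens_opE (I : finType) (G : I -> hilbertType R) (TG : tensorn G)
    (A : forall i, bop (G i) (G i)) (B : bop TG TG) :
  (forall f, B (tens TG f) = tens TG (fun i => A i (f i))) ->
  forall x, tens_op TG A x = B x.
Proof.
move=> hB; apply: (@bop_ext R TG TG _ _ _ _ (@tens_total _ _ TG)) => f; rewrite hB.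
exact: (@xgetPex _ (bop0 TG TG)
  [set B | forall f, B (tens TG f) = tens TG (fun i => A i (f i))] (ex_intro _ B hB)).
Qed.

Lemma coord_op0 (j : 'I_(n ord0)) x :
  coord_op (tensor_cons T) j x = adj (SA T j) x.
Proof.
move: x; apply: (tens_opE (TG := tensor_cons T)) => f.
rewrite /= /tens_cons ampl_adj dfwithin coord_mulopE; congr tens2; congr tens.
apply: functional_extensionality_dep => i.
by rewrite /tail_fam dfwithout // neq_lift.
Qed.

Lemma coord_op_lift (i : 'I_k) (j : 'I_(n (lift ord0 i))) :
  exists B : bop En En, forall x y,
    coord_op (tensor_cons T) j (tens2 T x y) = tens2 T x (B y).
Proof.
set X := coord_op _ _.
pose A := dfwith (fun l => bop1 (H l)) (lift ord0 i) (coord_mulop (H (lift ord0 i)) j).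
have A0 : A ord0 = bop1 (H ord0) by rewrite /A dfwithout // eq_sym neq_lift.
(* If no operator takes the values required by [tens_op], its default [0] makes [X] zero and [B = 0]
   serves; otherwise [X] takes these values. *)
have [hX|hX] := pselect (exists B : bop (tensor_cons T) (tensor_cons T),
    forall f, B (tens (tensor_cons T) f) = tens (tensor_cons T) (fun i => A i (f i))).
  have XE (f : forall l, H l) : X (tens2 T (f ord0) (tens En (fun l => f (lift ord0 l)))) =
      tens2 T (A ord0 (f ord0)) (tens En (fun l => A (lift ord0 l) (f (lift ord0 l)))).
    exact: (xgetPex (bop0 (tensor_cons T) (tensor_cons T)) hX).
  have Xg x (g : forall l : 'I_k, H (lift ord0 l)) :
      X (tens2 T x (tens En g)) = tens2 T x (tens En (fun l => A (lift ord0 l) (g l))).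
    have [f <- <-] := @fam_consP R k (fun l => H l : hilbertType R) x g.
    by rewrite (XE f) A0.
  (* The compression of [X] to the copy [1 (x) En] of [En]. *)
  pose B : bop En En := bcomp (adj (kap T)) (bcomp X (kap T)).
  exists B => x y.
  have h := @bop_ext _ _ _ (bcomp X (tensr T x)) (bcomp (tensr T x) B) _ _ (@tens_total _ _ En).
  have {}h : X (tensr T x y) = tensr T x (B y).
    rewrite -(bcompE X) -(bcompE (tensr T x)); apply: h => g.
    by rewrite !bcompE !tensrE !Xg adj_tensr inner_ker_one scale1r.
  by rewrite tensrE in h; rewrite h tensrE.
exists (bop0 En En) => x y; rewrite /X /coord_op /ampliation /tens_op xgetPN.
  by rewrite /= -tensrE linear0.
by move=> B hB; apply: hX; exists B.
Qed.

End Submodule.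

Theorem corollary6p1 (R : realType) (k : nat) (n : 'I_k.+1 -> nat)
    (hn : forall i, (0 < n i)%N)
    (H : forall i, drury_arveson R (n i))
    (En : tensorn (fun i : 'I_k => H (lift ord0 i)))
    (T : tensor2 (H ord0) En)
    (M : set (tensor_cons T)) (hM : is_closed_subspace M) :
  is_submodule M <->
  exists (E : hilbertType R) (TE : tensor2 (H ord0) E) (Theta : bop TE T)
         (Phi : forall i : 'I_k, 'I_(n (lift ord0 i)) -> bop TE TE),
    [/\ is_partial_isometry Theta,
        weak_tensor TE T (multiplier_algebra (H ord0)) Theta,
        forall i j, weak_tensor TE TE (multiplier_algebra (H ord0)) (Phi i j),
        M = range Theta
      & forall (i : 'I_k) (j : 'I_(n (lift ord0 i))) x,
          coord_op (tensor_cons T) j (Theta x) = Theta (Phi i j x)].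
Proof.
split=> [sub|[E [TE [Theta [Phi [_ wT _ MT hPhi]]]]] i j x]; last first.
  rewrite MT => -[y _ <-]; case: (unliftP ord0 i) j => [i' ->|->] j.
    by exists (Phi i' j y) => //; rewrite hPhi.
  exists (adj (SA TE j) y) => //; rewrite coord_op0; exact: weak_tensor_comm.
have [e [ee et]] := basis_ex (hn ord0) (H ord0).
pose TE := self_tensor T ee et.
pose V i : bop T T := tensr TE (e i).
have VV i j x y : inner (V i x) (V j y) = (i == j)%:R * inner x y.
  by rewrite /V !tensrE (tens2_inner TE) ee.
have MSA j x : M x -> M (adj (SA T j) x) by rewrite -coord_op0; exact: sub.
have [Theta [pT wT MT lift_]] := beurling TE VV hM MSA.
have hPhi (i : 'I_k) (j : 'I_(n (lift ord0 i))) : exists Phi : bop TE TE,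
    weak_tensor TE TE (multiplier_algebra (H ord0)) Phi /\
    forall x, coord_op (tensor_cons T) j (Theta x) = Theta (Phi x).
  have [B hB] := coord_op_lift T j.
  by apply: (lift_ (coord_op (tensor_cons T) j) B hB) => m; apply: sub.
exists T, TE, Theta, (fun i j => sval (cid (hPhi i j))); split=> //.
  by move=> i j; exact: (svalP (cid (hPhi i j))).1.
by move=> i j x; exact: (svalP (cid (hPhi i j))).2.
Qed.
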